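(* Let $0<c<1$ be fixed and let $\xi_n:S_n\to\{0,1\}$ be $$\xi_n:=\mathbb 1_{\{\pi\in S_n:\ \text{the length of the largest cycle in }\pi\text{ is at least }cn\}}.$$ Then the sequence $\{\xi_n\}_n$ is noise sensitive with respect to: (a) the interchange process on the star graph $\mathrm{Star}_n$; and (b) the continuous-time random walk on $S_n$ generated by all $s_n$-cycles, for any even integers $s_n$ (defined for $n\ge n_0$, some $n_0\geq 4$) with $2<s_n\le n$ and $s_n/n\to0$.
   Context: $S_n$ is the group of permutations of $[n]=\{1,\dots,n\}$ under composition. $\mathrm{Star}_n$ has vertex set $[n]$ and edge set $\{\{i,n\}:1\le i<n\}$. The interchange process on $\mathrm{Star}_n$ is the continuous-time Markov chain on $S_n$ with generator $(Qf)(\pi)=\nu'\sum_{i=1}^{n-1}\big(f(\pi\,(i,n))-f(\pi)\big)$, where $\nu'>0$ is a constant rate. The continuous-time random walk generated by all $s$-cycles is the chain on $S_n$ with generator $(Qf)(\pi)=\nu''\sum_{\sigma\in\mathscr C_s}\big(f(\pi\sigma)-f(\pi)\big)$, where $\mathscr C_s$ is the set of all $s$-cycles in $S_n$ and $\nu''>0$ is a constant rate. These chains are reversible and (for $s$ even) irreducible with uniform stationary distribution. Relaxation time: $t_{\rm rel}=1/\theta_1$, where $\theta_1$ is the smallest positive eigenvalue of $-Q$. A sequence $f_n:S_n\to\{0,1\}$ is noise sensitive with respect to reversible irreducible continuous-time Markov chains $X_n(t)$ on $S_n$ with stationary distributions $\pi_n$ and relaxation times $t^n_{\rm rel}$ if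 for all $\alpha>0$, $\lim_{n\to\infty}\mathrm{Cov}\big(f_n(X_n(0)),f_n(X_n(\alpha t^n_{\rm rel}))\big)=0$, where $X_n(0)\sim\pi_n$. *)

(* Defs.v *)
From HB Require Import structures.
From mathcomp Require Import all_boot all_order all_algebra all_fingroup.
From mathcomp Require Import all_classical all_reals all_analysis.
Set Implicit Arguments.
Unset Strict Implicit.
Unset Printing Implicit Defensive.
Import Order.TTheory GRing.Theory Num.Theory.
Import numFieldNormedType.Exports.
Local Open Scope classical_set_scope.
Local Open Scope ring_scope.

Section MarkovChains.
Variables (R : realType) (S : finType).
Implicit Types (Q : (S -> R) -> (S -> R)) (mu : S -> R).

(* (e^{tQ} f)(x), with exp_coeff t k = t ^+ k / k`! *)
Definition semigroup Q (t : R) (f : S -> R) (x : S) : R :=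
  limn (series (fun k => exp_coeff t k * iter k Q f x)).

(* P_t(x, y) = (e^{tQ} 1_{y})(x) *)
Definition transition Q (t : R) (x y : S) : R :=
  semigroup Q t (fun z => (z == y)%:R) x.

(* X is a continuous-time Markov chain on S with generator Q and initial
   distribution mu, expressed by its finite-dimensional distributions at times
   0 = t 0 <= t 1 <= ... <= t k.  The values X t at t < 0 are irrelevant. *)
Definition is_markov_chain (d : measure_display) (Omega : measurableType d)
    (P : probability Omega R) Q mu (X : R -> Omega -> S) : Prop :=
  (forall t y, 0 <= t -> measurable (X t @^-1` [set y])) /\
  (forall (k : nat) (t : nat -> R) (x : nat -> S),
     t 0%N = 0 -> {homo t : i j / (i <= j)%N >-> i <= j} ->
     P (\bigcap_(i in `I_k.+1) (X (t i) @^-1` [set x i])) =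
     (mu (x 0%N) *
      \prod_(i < k) transition Q (t i.+1 - t i) (x i) (x i.+1))%:E).

Definition eigenvalue_of_opp Q (a : R) : Prop :=
  exists2 f : S -> R, (exists x, f x != 0) & forall x, - Q f x = a * f x.

(* The set below is finite, so that its infimum is the smallest positive
   eigenvalue of - Q as soon as there is one. *)
Definition spectral_gap Q : R :=
  inf [set a : R | 0 < a /\ eigenvalue_of_opp Q a].

Definition relaxation_time Q : R := (spectral_gap Q)^-1.

Definition uniform_dist : S -> R := fun=> (#|S|%:R)^-1.

End MarkovChains.

Arguments uniform_dist R S : clear implicits.

(* Meant for generators Q n that, for n large, are irreducible and reversible
   with respect to mu n.  The covariance depends only on the law of
   (X 0, X t), hence not on the realization of the chain that is chosen. *)
Definition noise_sensitive (R : realType) (S : nat -> finType)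
    (Q : forall n, (S n -> R) -> (S n -> R)) (mu : forall n, S n -> R)
    (f : forall n, S n -> bool) : Prop :=
  forall alpha : R, 0 < alpha ->
  forall (d : nat -> measure_display) (Omega : forall n, measurableType (d n))
    (P : forall n, probability (Omega n) R)
    (X : forall n, R -> Omega n -> S n),
    (forall n, is_markov_chain (P n) (Q n) (mu n) (X n)) ->
    covariance (P n)
      (fun w => (f n (X n 0 w))%:R)
      (fun w => (f n (X n (alpha * relaxation_time (Q n)) w))%:R)
      @[n --> \oo] --> 0%E.

(* Permutations act on 'I_n = {0, ..., n - 1}; the vertex called n in [n] is
   the element of value n - 1. *)
Section Permutations.
Variables (R : realType) (n : nat).

(* f |-> (pi |-> nu \sum_(sigma in A) (f (pi o sigma) - f pi)).  The product
   of {perm T} is left-to-right, (s * t) x = t (s x), so pi o sigma is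
   (sigma * pi)%g. *)
Definition walk_generator (nu : R) (A : {set 'S_n})
    (f : 'S_n -> R) (pi : 'S_n) : R :=
  nu * \sum_(sigma in A) (f (sigma * pi)%g - f pi).

Definition star : rel 'I_n :=
  [rel i j : 'I_n | (i != j) && ((i.+1 == n) || (j.+1 == n))].

Definition edge_transpositions (e : rel 'I_n) : {set 'S_n} :=
  [set tperm p.1 p.2 | p : 'I_n * 'I_n & e p.1 p.2]%SET.

Definition interchange_generator (nu : R) (e : rel 'I_n) :=
  walk_generator nu (edge_transpositions e).

(* For s >= 2: a single cycle of length s, every other point being fixed. *)
Definition s_cycles (s : nat) : {set 'S_n} :=
  [set sigma : 'S_n |
    [exists x, (#|porbit sigma x| == s) && perm_on (porbit sigma x) sigma]]%SET.

Definition cycle_generator (nu : R) (s : nat) :=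
  walk_generator nu (s_cycles s).

Definition largest_cycle (pi : 'S_n) : nat :=
  (\max_(C in porbits pi) #|C|)%N.

Definition has_large_cycle (c : R) (pi : 'S_n) : bool :=
  c * n%:R <= (largest_cycle pi)%:R.

End Permutations.

(* Main.v *)
Require Import Defs.
From HB Require Import structures.
From mathcomp Require Import all_boot all_order all_algebra all_fingroup.
From mathcomp Require Import all_classical all_reals all_analysis.
From mathcomp Require Import ring lra zify.
From mathcomp Require Import fintype finset.
Import Order.TTheory GRing.Theory Num.Theory.
Import numFieldNormedType.Exports.
Set Implicit Arguments.
Unset Strict Implicit.
Unset Printing Implicit Defensive.
Local Open Scope ring_scope.

(** Let K be the operator that averages over left translations by the
    generators, so that the generator of the walk is r (K - 1) with r the total
    jump rate, and let F be the centred indicator of a large cycle. At time t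
    the number of jumps is Poisson of mean r t, and the covariance is the
    corresponding mixture of the correlations of F with K ^ j F, each at most
    the squared norm of K ^ (j / 2) F (covariance_law_le). An explicit
    eigenfunction, a function of the position of one point, bounds the spectral
    gap from above (star_eigenvalue, conj_set_eigenvalue). Hence the mean number
    of jumps up to a fixed multiple of the relaxation time tends to infinity, and
    it suffices that the normalized squared norm of K ^ J F be small, for some J
    chosen independently of n, once n is large (iter_sqnorm_centered_small).

    The squared norms decrease, so some g = K ^ (2 i) F with i < J loses at most
    a proportion 1 / J of the squared norm of F when K is applied once more. Such
    a g is almost invariant under the product of two random generators
    (sum_defect). Taking quotients of such products, g is almost invariant under
    the products (j z)(i z) of two transpositions with a common point z
    (defect_conj_quotient, reaches_star_pairs), and therefore under all even
    permutations of a fixed finite set B (defect_even). The squared norm of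
    K ^ J F is at most the correlation of F with g, so it remains to prove that
    F is almost orthogonal to every bounded g of mean 0 with this invariance.

    To see this, take A inside B inside the set of all n points, both of size
    independent of n. The share of A that lies in a cycle estimates the share of
    all points that lie in it, so with high probability a permutation has a cycle
    of length at least c n exactly when one of its cycles contains at least
    c #|A| points of A (card_large_mismatch). The second event depends only on
    the permutation induced on A by first return. If s is multiplied by a uniform
    permutation of B, the permutation induced on A becomes uniform, whatever s is
    (sum_translate_const); restricting to even permutations costs only a
    correction of order (#|A| / #|B|) ^ 2 (sum_perm_sign_le). Averaging over the
    even permutations of B, which hardly changes g, thus turns the indicator of
    the second event into a constant, and constants are orthogonal to g
    (insertion_invariant_correlation). *)

(** * Inserting a point into a cycle *)

Section InsertPoint.
Variable T : finType.
Implicit Types (s : {perm T}) (B : {set T}).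

Lemma porbit_sub s (D : {set T}) y :
  y \in D -> {in D, forall z, s z \in D} -> porbit s y \subset D.
Proof.
move=> yD sD; apply/subsetP => z /porbitP[i ->].
elim: i => [|i IHi]; first by rewrite expg0 perm1.
by rewrite expgSr permM sD.
Qed.

Lemma porbit_closed s y z : z \in porbit s y -> s z \in porbit s y.
Proof.
move=> /porbitP[i ->]; rewrite -permM -expgSr; exact: mem_porbit.
Qed.

Lemma porbit_fixed s x y : s x = x -> (x \in porbit s y) = (x == y).
Proof.
move=> sx; rewrite porbit_sym; apply/idP/eqP => [|->]; last exact: porbit_id.
have /subsetP/(_ y) : porbit s x \subset [set x]%SET.
  by apply: porbit_sub => [|z]; rewrite ?set11// !inE => /eqP ->; rewrite sx.
by move=> /[apply]; rewrite inE => /eqP.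
Qed.

(** The product sends x to c and the point that s sends to c to x: it threads x
    into the cycle of c just before c and leaves the other cycles alone. *)
Lemma porbit_insert s x c y : s x = x -> y != x ->
  porbit (s * tperm x c)%g y =
  if c \in porbit s y then (x |: porbit s y)%SET else porbit s y.
Proof.
move=> sx yx; set t := tperm x c.
have xNs : x \notin porbit s y by rewrite porbit_fixed// eq_sym.
have sNx w : w != x -> s w != x.
  by apply: contra => /eqP swx; apply/eqP/(@perm_inj _ s); rewrite swx sx.
have le1 : porbit (s * t)%g y \subset
    if c \in porbit s y then (x |: porbit s y)%SET else porbit s y.
  apply: porbit_sub; first by case: ifP; rewrite ?inE porbit_id ?orbT.
  move=> w wD; rewrite permM.
  have [wx|wx] := eqVneq w x.
    rewrite wx sx tpermL; move: wD; rewrite wx.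
    case: ifP => cP; first by rewrite !inE cP orbT.
    by rewrite (negPf xNs).
  have wP : w \in porbit s y.
    by move: wD; case: ifP => // _; rewrite !inE (negPf wx).
  have swP := porbit_closed wP.
  rewrite /t; case: tpermP => [swx|swc|_ _].
  - by move: (sNx _ wx); rewrite swx eqxx.
  - by rewrite -swc swP !inE eqxx.
  - by case: ifP => _; rewrite ?inE swP ?orbT.
have le2 : porbit s y \subset (porbit (s * t)%g y :\ x)%SET.
  apply: porbit_sub; first by rewrite !inE yx porbit_id.
  move=> w; rewrite !inE => /andP[wx wP]; rewrite sNx//=.
  have := porbit_closed wP; rewrite permM /t.
  case: tpermP => [swx|swc|//].
  - by move: (sNx _ wx); rewrite swx eqxx.
  - by move=> xP; have := porbit_closed xP; rewrite permM sx tpermL swc.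
apply/eqP; rewrite eqEsubset le1 /=.
case: ifP => cP; last by apply: subset_trans le2 (subsetDl _ _).
rewrite subUset (subset_trans le2 (subsetDl _ _)) andbT sub1set.
have := subsetP le2 _ cP; rewrite !inE => /andP[cx cP'].
have <- : (s * t)%g ((s^-1)%g c) = x by rewrite permM permKV tpermR.
apply: porbit_closed; apply: (subsetP (subset_trans le2 (subsetDl _ _))).
by rewrite -porbitV; apply: porbit_closed; rewrite porbitV.
Qed.

Lemma perm_on_fix s B x : x \in B -> perm_on (B :\ x)%SET s = perm_on B s && (s x == x).
Proof.
move=> xB; apply/idP/andP => [/subsetP sB|[/subsetP sB /eqP sx]].
  split; last first.
    apply/eqP; have := sB x; rewrite !inE eqxx /=.
    by case: eqP => // _ /(_ isT).
  by apply/subsetP => y /sB; rewrite !inE => /andP[].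
apply/subsetP => y yP; rewrite !inE sB// andbT.
by apply: contraTneq yP => ->; rewrite inE sx eqxx.
Qed.

Lemma perm_on_tperm B x y : x \in B -> y \in B -> perm_on B (tperm x y).
Proof.
move=> xB yB; apply: subset_trans (tperm_on x y) _.
by apply/subsetP => z; rewrite !inE => /orP[] /eqP ->.
Qed.

(** A permutation of B arises exactly once by inserting x, in front of some c, in
    a permutation of the other points; c is the image of x, and c = x makes x a
    fixed point. This is the recursion of the Chinese restaurant process. *)
Lemma sum_perm_on_insert (V : nmodType) B x (h : {perm T} -> V) : x \in B ->
  \sum_(s | perm_on B s) h s =
  \sum_(s | perm_on (B :\ x)%SET s) \sum_(c in B) h (s * tperm x c)%g.
Proof.
move=> xB; rewrite (partition_big (fun s : {perm T} => s x) (mem B)) /=; last first.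
  by move=> s sB; rewrite perm_closed.
rewrite [RHS]exchange_big /=; apply: eq_bigr => c cB.
rewrite (reindex_onto (fun s => s * tperm x c)%g (fun s => s * tperm x c)%g) /=; last first.
  by move=> s _; rewrite -mulgA tperm2 mulg1.
apply: eq_bigl => s; rewrite -mulgA tperm2 mulg1 eqxx andbT perm_on_fix//.
rewrite permM; have -> : (tperm x c (s x) == c) = (s x == x).
  by rewrite -[X in _ == X](tpermL x c) (inj_eq perm_inj).
congr (_ && _); apply/idP/idP => sB.
  by rewrite -[s]mulg1 -(tperm2 x c) mulgA perm_onM// perm_on_tperm.
by rewrite perm_onM// perm_on_tperm.
Qed.

End InsertPoint.

Section InsertionInvariance.
Variables (R : realFieldType) (T : finType).
Implicit Types (s : {perm T}) (B : {set T}).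

(** Such an h depends only on the permutation that s induces on A by first
    return. The condition is stated through insertions of points rather than through
    the induced permutation, which would be a permutation of a subtype. *)
Definition insertion_invariant (V : Type) (A : {set T}) (h : {perm T} -> V) :=
  forall s x c, x \notin A -> s x = x -> h (s * tperm x c)%g = h s.

(** The points outside B are removed from the cycles of s one at a time, by
    transpositions on the right. The left factor r fixes these points, so the same
    transpositions remove them from r * s. *)
Lemma insertion_invariant_translate (V : Type) (A B : {set T}) (h : {perm T} -> V) s :
  insertion_invariant A h -> A \subset B ->
  exists2 s0, perm_on B s0 &
    forall r, perm_on B r -> h (r * s)%g = h (r * s0)%g.
Proof.
move=> hA /subsetP AB.
suff H k (D : {set T}) s1 : B \subset D -> #|(D :\: B)%SET| = k -> perm_on D s1 ->
    exists2 s0, perm_on B s0 &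
    forall r, perm_on B r -> h (r * s1)%g = h (r * s0)%g.
  by apply: (H _ [set: T]%SET s) => //; apply/subsetP => x; rewrite inE.
elim: k D s1 => [|k IHk] D s1 BD.
  move/eqP; rewrite cards_eq0 setD_eq0 => DB s1D; exists s1 => //.
  exact: subset_trans s1D DB.
move=> kE s1D; have : (0 < #|(D :\: B)%SET|)%N by rewrite kE.
case/card_gt0P => x; rewrite !inE => /andP[xB xD].
pose s2 := (s1 * tperm x (s1 x))%g.
have s2x : s2 x = x by rewrite permM tpermR.
have s2D : perm_on (D :\ x)%SET s2.
  by rewrite perm_on_fix// s2x eqxx andbT perm_onM// perm_on_tperm// perm_closed.
have BDx : B \subset (D :\ x)%SET by rewrite subsetD1 BD xB.
have cDx : #|((D :\ x) :\: B)%SET| = k.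
  have := cardsD1 x (D :\: B)%SET; rewrite !inE xB xD kE => -[->].
  by apply: eq_card => y; rewrite !inE; case: (y \in B); rewrite ?andbF ?andbT.
have [s0 s0B hs0] := IHk _ s2 BDx cDx s2D.
exists s0 => // r rB; rewrite -hs0//.
have -> : (r * s1 = (r * s2) * tperm x (s1 x))%g by rewrite /s2 -!mulgA tperm2 mulg1.
apply: hA; first by apply: contra xB; exact: AB.
by rewrite permM (out_perm rB).
Qed.

Definition perm_sign s : R := (-1) ^+ odd_perm s.

Lemma perm_signM s t : perm_sign (s * t)%g = perm_sign s * perm_sign t.
Proof. by rewrite /perm_sign odd_permM signr_addb. Qed.

Lemma perm_signK s : perm_sign s * perm_sign s = 1.
Proof. by rewrite -expr2 sqrr_sign. Qed.

Lemma normr_perm_sign s : `|perm_sign s| = 1.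
Proof. by rewrite /perm_sign normr_sign. Qed.

(** Of the #|B| ways to insert x only one, c = x, preserves the sign. *)
Lemma sum_perm_sign_insert (A B : {set T}) x (h : {perm T} -> R) :
  insertion_invariant A h -> x \in B -> x \notin A ->
  \sum_(s | perm_on B s) perm_sign s * h s =
  (2 - #|B|%:R) * \sum_(s | perm_on (B :\ x)%SET s) perm_sign s * h s.
Proof.
move=> hA xB xA; rewrite (sum_perm_on_insert _ xB) mulr_sumr.
apply: eq_bigr => s; rewrite perm_on_fix// => /andP[sB /eqP sx].
rewrite (eq_bigr (fun c => (perm_sign s * h s) * (-1) ^+ (x != c))); last first.
  by move=> c cB; rewrite hA// perm_signM /perm_sign odd_tperm mulrAC.
rewrite -mulr_sumr mulrC; congr (_ * _).
rewrite (bigD1 x)//= eqxx expr0 (eq_bigr (fun=> -1)); last first.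
  by move=> c /andP[_ cx]; rewrite eq_sym cx expr1.
rewrite sumr_const (cardD1 x B) xB /= natrD.
have -> : #|[pred i in B | i != x]| = #|[predD1 B & x]|.
  by apply: eq_card => y; rewrite !inE andbC.
by rewrite mulNrn; ring.
Qed.

(** The factors of sum_perm_sign_insert telescope from B down to A. The sign of a
    uniform permutation of a large B is thus almost uncorrelated with what happens
    on A. *)
Lemma sum_perm_sign_le (A B : {set T}) (h : {perm T} -> R) :
  insertion_invariant A h -> (forall s, `|h s| <= 1) -> A \subset B ->
  `|\sum_(s | perm_on B s) perm_sign s * h s| * (#|B| * #|B|.-1)%:R <=
  ((#|B|)`! * (#|A| ^ 2))%:R.
Proof.
move=> hA h1.
have [k] := ubnP #|(B :\: A)%SET|; elim: k B => // k IHk B leBk AB.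
have [BA|] := boolP (B \subset A).
  have -> : B = A by apply/eqP; rewrite eqEsubset BA.
  rewrite [in leRHS]natrM; apply: ler_pM => //.
    rewrite -card_perm -sum1_card natr_sum.
    apply: le_trans (ler_norm_sum _ _ _) _; apply: ler_sum => s _.
    by rewrite normrM normr_perm_sign mul1r.
  by rewrite ler_nat; nia.
case/subsetPn => x xB xA; rewrite (sum_perm_sign_insert hA xB xA).
have ABx : A \subset (B :\ x)%SET by rewrite subsetD1 AB xA.
have cB : #|B| = #|(B :\ x)%SET|.+1 by rewrite (cardsD1 x B) xB.
have /IHk/(_ ABx) : (#|(B :\ x)%SET :\: A|%SET < k)%N.
  apply: leq_trans (_ : #|(B :\: A)%SET| <= k)%N; last by rewrite -ltnS.
  rewrite [X in (_ < X)%N](cardsD1 x) !inE xB xA ltnS; apply: subset_leq_card.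
  by apply/subsetP => y; rewrite !inE => /and3P[-> -> ->].
set W := `|\sum_(s | perm_on (B :\ x) s) _|; rewrite cB; move: #|(B :\ x)%SET| => b.
move=> IH; rewrite normrM -/W /=.
have [->|b0] := posnP b; first by rewrite muln0 mulr0.
have -> : `|2 - b.+1%:R| = b.-1%:R :> R.
  case: b b0 {IH} => // b _ /=; rewrite -normrN opprB -[b.+2]addn2 natrD addrK.
  by rewrite ger0_norm.
have -> : b.-1%:R * W * (b.+1 * b)%:R = b.+1%:R * (W * (b * b.-1)%:R).
  by rewrite !natrM; ring.
by rewrite factS -mulnA [in leRHS]natrM ler_wpM2l.
Qed.

(** When r is uniform on the permutations of B, the permutation that r * s induces
    on B is uniform, whatever s is. *)
Lemma sum_translate_const (A B : {set T}) (h : {perm T} -> R) s :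
  insertion_invariant A h -> A \subset B ->
  \sum_(r | perm_on B r) h (r * s)%g = \sum_(r | perm_on B r) h r.
Proof.
move=> hA AB; have [s0 s0B hs0] := insertion_invariant_translate s hA AB.
rewrite (eq_bigr _ hs0) [RHS](reindex_inj (mulIg s0)); apply: eq_bigl => r.
apply/idP/idP => rB; first exact: perm_onM.
by rewrite -[r](mulgK s0) perm_onM// perm_onV.
Qed.

Lemma sum_perm_sign_translate_norm (A B : {set T}) (h : {perm T} -> R) s :
  insertion_invariant A h -> A \subset B ->
  `|\sum_(r | perm_on B r) perm_sign r * h (r * s)%g| = `|\sum_(r | perm_on B r) perm_sign r * h r|.
Proof.
move=> hA AB; have [s0 s0B hs0] := insertion_invariant_translate s hA AB.
rewrite (eq_bigr (fun r => perm_sign s0 * (perm_sign (r * s0)%g * h (r * s0)%g))); last first.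
  by move=> r rB; rewrite hs0// perm_signM [perm_sign r * perm_sign s0]mulrC !mulrA perm_signK mul1r.
rewrite -mulr_sumr normrM normr_perm_sign mul1r; congr (`| _ |).
rewrite [RHS](reindex_inj (mulIg s0)); apply: eq_bigl => r.
apply/idP/idP => rB; first exact: perm_onM.
by rewrite -[r](mulgK s0) perm_onM// perm_onV.
Qed.

End InsertionInvariance.

(** * Cycle lengths of a uniform permutation *)

Section OrbitLength.
Variable T : finType.
Implicit Types (s : {perm T}) (B : {set T}).

(** The length of the cycle of x is uniform on 1, ..., #|B|, whence the bound: a new
    point y enters a cycle with probability proportional to its length, as in the
    Polya urn, and this preserves uniformity. *)
Lemma card_porbit_length_le B x l : x \in B ->
  (\sum_(s : {perm T} | perm_on B s) (#|porbit s x| == l) <= (#|B|.-1)`!)%N.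
Proof.
have [k] := ubnP #|B|; elim: k B l => // k IHk B l; rewrite ltnS => leBk xB.
have [Bx|] := boolP (B \subset [set x]%SET).
  have B1 : (#|B| <= 1)%N by rewrite -(cards1 x) subset_leq_card.
  rewrite (eq_bigl (pred1 (1%g : {perm T}))) ?big_pred1_eq; last first.
    move=> s /=; apply/idP/eqP => [sB|->]; last exact: perm_on1.
    exact: (perm_on_id sB).
  by apply: leq_trans (leq_b1 _) (fact_gt0 _).
case/subsetPn => y yB; rewrite inE => yx.
have cB : #|B| = #|(B :\ y)%SET|.+1 by rewrite (cardsD1 y B) yB.
have xBy : x \in (B :\ y)%SET by rewrite !inE eq_sym yx.
have -> : (\sum_(s : {perm T} | perm_on B s) (#|porbit s x| == l) =
    \sum_(s | perm_on (B :\ y)%SET s) \sum_(c in B) (#|porbit (s * tperm y c)%g x| == l))%N.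
  exact: (sum_perm_on_insert (fun s => nat_of_bool (#|porbit s x| == l)) yB).
rewrite cB /=.
set b := #|(B :\ y)%SET| in cB *.
have b0 : (0 < b)%N by rewrite card_gt0; apply/set0Pn; exists x.
have step s : perm_on (B :\ y)%SET s ->
    (\sum_(c in B) (#|porbit (s * tperm y c)%g x| == l) =
     (#|porbit s x| == l) * (b.+1 - l) + (#|porbit s x| == l.-1) * l.-1)%N.
  rewrite perm_on_fix// => /andP[sB /eqP sy].
  have yP : y \notin porbit s x by rewrite porbit_fixed.
  have PB : porbit s x \subset B.
    apply: porbit_sub => // z; by rewrite perm_closed.
  have l0 : (0 < #|porbit s x|)%N by rewrite lt0n card_porbit_neq0.
  rewrite (eq_bigr (fun c => if c \in porbit s x
    then nat_of_bool (#|porbit s x|.+1 == l) else nat_of_bool (#|porbit s x| == l)));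
    last first.
    move=> c _; rewrite porbit_insert// ?(eq_sym x)//; case: ifP => // _.
    by rewrite cardsU1 yP add1n.
  rewrite (bigID (mem (porbit s x))) /= addnC.
  congr (_ + _)%N.
  - rewrite (eq_bigr (fun=> nat_of_bool (#|porbit s x| == l))); last first.
      by move=> c /andP[_ /negPf ->].
    rewrite sum_nat_const mulnC; case: eqVneq => [<-|]; rewrite ?mul0n// !mul1n.
    rewrite -cB -(cardsID (porbit s x) B) (setIidPr PB) addKn.
    by apply: eq_card => z; rewrite !inE andbC.
  - rewrite (eq_bigr (fun=> nat_of_bool (#|porbit s x|.+1 == l))); last first.
      by move=> c /andP[_ ->].
    rewrite sum_nat_const mulnC.
    have -> : #|[pred i in B | i \in porbit s x]| = #|porbit s x|.
      by apply: eq_card => z; rewrite !inE andb_idl// => /(subsetP PB).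
    case: l => [|l] /=; first by rewrite muln0.
    by rewrite eqSS; case: eqVneq => [->|].
rewrite (eq_bigr _ step) big_split /= -!big_distrl /=.
have IH l' := IHk (B :\ y)%SET l' (leq_trans (eq_leq (esym cB)) leBk) xBy.
have [lb|lb] := leqP l b.
  have [l0|l0] := posnP l.
    subst l; rewrite muln0 addn0 big1 ?mul0n// => s _.
    by rewrite (negPf (card_porbit_neq0 _ _)).
  apply: leq_trans (leq_add (leq_mul (IH l) (leqnn _)) (leq_mul (IH l.-1) (leqnn _))) _.
  rewrite -/b -mulnDr -[b in leqRHS](prednK b0) factS prednK// mulnC leq_mul2r.
  by apply/orP; right; lia.
rewrite big1 => [|s sB]; last first.
  apply/eqP; rewrite eqb0 neq_ltn (leq_ltn_trans _ lb)//.
  by apply: subset_leq_card; apply: porbit_sub => // z; rewrite perm_closed.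
have [lb1|lb1] := leqP l.-1 b.
  rewrite add0n; apply: leq_trans (leq_mul (IH l.-1) lb1) _.
  by rewrite -/b -[b in leqRHS](prednK b0) factS prednK// mulnC.
rewrite big1 ?mul0n// => s sB.
apply/eqP; rewrite eqb0 neq_ltn (leq_ltn_trans _ lb1)//.
by apply: subset_leq_card; apply: porbit_sub => // z; rewrite perm_closed.
Qed.

Lemma card_perm_type : #|{perm T}| = (#|T|)`!.
Proof.
rewrite -[in RHS]cardsT -card_perm; apply: eq_card => s.
by apply/esym/subsetP => z; rewrite inE.
Qed.

(** If one cycle has its length in the window, then at least a points lie on such
    cycles. The expected number of these points is at most b + 1 - a. *)
Lemma card_porbit_window (a b : nat) :
  (#|[set s : {perm T} | [exists x, (a <= #|porbit s x| <= b)%N]]| * a <=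
   (b.+1 - a) * (#|T|)`!)%N.
Proof.
apply: (@leq_trans (\sum_(s : {perm T}) \sum_x (a <= #|porbit s x| <= b)%N)).
  rewrite -sum1_card big_distrl /= [X in (_ <= X)%N](bigID
    (mem [set s : {perm T} | [exists x, (a <= #|porbit s x| <= b)%N]]%SET)) /=.
  apply: leq_trans (leq_addr _ _); apply: leq_sum => s; rewrite inE => /existsP[x xP].
  rewrite mul1n; case/andP: (xP) => ax _; apply: leq_trans ax _.
  rewrite -sum1_card [X in (_ <= X)%N](bigID (mem (porbit s x))) /=.
  apply: leq_trans (leq_addr _ _); apply: leq_sum => y yP.
  by move: xP; rewrite -eq_porbit_mem in yP; rewrite (eqP yP) => ->.
rewrite exchange_big /=.
apply: (@leq_trans (\sum_(x : T) (b.+1 - a) * (#|T|.-1)`!)%N); last first.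
  rewrite sum_nat_const mulnCA; have [->|T0] := posnP #|T|; first by rewrite mul0n muln0.
  by rewrite -{1}(prednK T0) -factS prednK.
apply: leq_sum => x _.
apply: (@leq_trans (\sum_(s : {perm T}) \sum_(a <= l < b.+1) (#|porbit s x| == l))%N).
  apply: leq_sum => s _; case: (boolP (_ <= _ <= _)%N) => // xP.
  rewrite (bigD1_seq #|porbit s x|) ?eqxx ?iota_uniq// mem_index_iota.
  by rewrite ltnS.
rewrite exchange_big /=.
rewrite -sum_nat_const_nat.
apply: leq_sum => l _.
rewrite -cardsT; apply: leq_trans (card_porbit_length_le l (in_setT x)).
rewrite [X in (_ <= X)%N]big_mkcond /=; apply: leq_sum => s _.
by rewrite ifT//; apply/subsetP => z; rewrite inE.
Qed.

End OrbitLength.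

Section TwoTransitive.
Variable T : finType.
Implicit Types (s : {perm T}).

(** Used to replace two distinct points by two others in a sum over all
    permutations, by conjugation. *)
Lemma perm_pair (i j k l : T) : i != j -> k != l ->
  exists2 t : {perm T}, t i = k & t j = l.
Proof.
move=> ij kl; exists (tperm i k * tperm (tperm i k j) l)%g; last by rewrite permM tpermL.
rewrite permM tpermL tpermD 1?eq_sym//.
by rewrite -[X in X != _](tpermL i k) (inj_eq perm_inj).
Qed.

Lemma perm_triple (i j k i' j' k' : T) :
  i != j -> j != k -> i != k -> i' != j' -> j' != k' -> i' != k' ->
  exists t : {perm T}, [/\ t i = i', t j = j' & t k = k'].
Proof.
move=> ij jk ik ij' jk' ik'; have [t ti tj] := perm_pair ij ij'.
exists (t * tperm (t k) k')%g; rewrite !permM ti tj tpermL; split => //.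
  by rewrite tpermD// 1?eq_sym// -ti (inj_eq perm_inj).
by rewrite tpermD// 1?eq_sym// -tj (inj_eq perm_inj).
Qed.

Lemma porbitJ s (t : {perm T}) x y :
  (t y \in porbit (s ^ t)%g (t x)) = (y \in porbit s x).
Proof.
apply/porbitP/porbitP => -[i E]; exists i; last by rewrite -conjXg permJ E.
by apply: (@perm_inj _ t); rewrite E -conjXg permJ.
Qed.

Lemma card_porbitJ s (t : {perm T}) x : #|porbit (s ^ t)%g (t x)| = #|porbit s x|.
Proof.
have <- : (t @: porbit s x)%SET = porbit (s ^ t)%g (t x).
  apply/setP => y; rewrite -(permKV t y) porbitJ mem_imset//; exact: perm_inj.
by rewrite card_imset//; exact: perm_inj.
Qed.

End TwoTransitive.

Section Sampling.
Variables (R : realFieldType) (T : finType) (w : T -> R).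
Implicit Types (s : {perm T}).

(** This is the sum over the cycles of the squared w-mass of the cycle
    (orbit_energyE), written as a double sum so that it can be averaged over s. *)
Definition orbit_energy s := \sum_i \sum_j w i * w j * (j \in porbit s i)%:R.

Lemma orbit_energyE s :
  orbit_energy s = \sum_(C in porbits s) (\sum_(i in C) w i) ^+ 2.
Proof.
rewrite /orbit_energy (partition_big (porbit s) (mem (porbits s))) /=; last first.
  by move=> i _; apply: imset_f.
apply: eq_bigr => C /imsetP[x _ ->].
rewrite expr2 mulr_suml; apply: eq_big => i; first by rewrite eq_porbit_mem.
move=> /eqP <-; rewrite mulr_sumr [RHS]big_mkcond /=; apply: eq_bigr => j _.
by case: ifP; rewrite ?mulr1 ?mulr0.
Qed.

Lemma orbit_energy_ge s x : (\sum_(i in porbit s x) w i) ^+ 2 <= orbit_energy s.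
Proof.
rewrite orbit_energyE (bigD1 (porbit s x)) ?imset_f//=.
by rewrite lerDl sumr_ge0// => C _; rewrite sqr_ge0.
Qed.

(** Two distinct points lie on the same cycle with a probability p that does not
    depend on them. If w has total mass 0, the average energy is therefore 1 - p
    times the sum of the squares. *)
Lemma sum_orbit_energy : \sum_i w i = 0 ->
  \sum_(s : {perm T}) orbit_energy s <= ((#|T|)`!)%:R * \sum_i w i ^+ 2.
Proof.
move=> w0; pose q i j : R := \sum_(s : {perm T}) (j \in porbit s i)%:R.
have [p p0 qp] : exists2 p : R, 0 <= p & forall i j, i != j -> q i j = p.
  have [/existsP[i0 /existsP[j0 ij0]]|] := boolP [exists i : T, exists j : T, i != j].
    exists (q i0 j0) => [|i j ij]; first by apply: sumr_ge0 => s _.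
    have [t <- <-] := perm_pair ij0 ij.
    rewrite /q (reindex_inj (conjg_inj t)) /=.
    by apply: eq_bigr => s _; rewrite porbitJ.
  move=> /existsPn H; exists 0 => // i j ij.
  by have /existsPn/(_ j) := H i; rewrite ij.
have qii i : q i i = ((#|T|)`!)%:R.
  rewrite /q (eq_bigr (fun=> 1)) => [|s _]; last by rewrite porbit_id.
  by rewrite sumr_const card_perm_type.
rewrite /orbit_energy exchange_big /=.
under eq_bigr do rewrite exchange_big /=.
have -> : \sum_i \sum_j \sum_(s : {perm T}) w i * w j * (j \in porbit s i)%:R =
   \sum_i ((((#|T|)`!)%:R - p) * w i ^+ 2).
  apply: eq_bigr => i _; under eq_bigr do rewrite -mulr_sumr.
  rewrite (bigD1 i)//= -/(q i i) qii.
  rewrite (eq_bigr (fun j => p * w i * w j)); last first.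
    by move=> j ji; rewrite -/(q i j) qp 1?eq_sym// mulrC mulrA.
  rewrite -mulr_sumr.
  have -> : \sum_(j | j != i) w j = - w i.
    by have /eqP := w0; rewrite (bigD1 i)//= addrC addr_eq0 => /eqP.
  by ring.
rewrite -mulr_sumr ler_wpM2r//; first by apply: sumr_ge0 => i _; rewrite sqr_ge0.
by rewrite gerBl.
Qed.

(** Chebyshev's inequality, simultaneously for all cycles. *)
Lemma card_orbit_deviation (e : R) : \sum_i w i = 0 -> 0 <= e ->
  #|[set s : {perm T} | [exists x, e <= `|\sum_(i in porbit s x) w i|]]|%:R * e ^+ 2 <=
  ((#|T|)`!)%:R * \sum_i w i ^+ 2.
Proof.
move=> w0 e0; apply: le_trans _ (sum_orbit_energy w0).
rewrite -sum1_card natr_sum mulr_suml big_mkcond /=; apply: ler_sum => s _.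
case: ifP; last by move=> _; rewrite orbit_energyE sumr_ge0// => C _; rewrite sqr_ge0.
rewrite inE => /existsP[x ex]; rewrite mul1r; apply: le_trans _ (orbit_energy_ge s x).
by rewrite -[leRHS]real_normK ?num_real// lerXn2r// nnegrE.
Qed.

End Sampling.

(** * Almost invariance under even permutations and large cycles *)

Section TranslationDefect.
Variables (R : realFieldType) (gT : finGroupType) (g : gT -> R).
Implicit Types (r s : gT).

Definition defect r : R := \sum_s (g (r * s)%g - g s) ^+ 2.

Lemma defect_ge0 r : 0 <= defect r.
Proof. by apply: sumr_ge0 => s _; rewrite sqr_ge0. Qed.

Lemma defect1 : defect 1%g = 0.
Proof. by apply: big1 => s _; rewrite mul1g subrr expr0n. Qed.

Lemma defectV r : defect r^-1%g = defect r.
Proof.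
rewrite /defect (reindex_inj (mulgI r)) /=; apply: eq_bigr => s _.
by rewrite mulKg -sqrrN opprB.
Qed.

Lemma defectM r1 r2 : defect (r1 * r2)%g <= 2 * (defect r1 + defect r2).
Proof.
have -> : defect r1 = \sum_s (g (r1 * r2 * s)%g - g (r2 * s)%g) ^+ 2.
  rewrite /defect (reindex_inj (mulgI r2)) /=.
  by apply: eq_bigr => s _; rewrite mulgA.
rewrite -big_split /= mulr_sumr; apply: ler_sum => s _.
move: (g (r1 * r2 * s)%g) (g (r2 * s)%g) (g s) => x y u.
by rewrite -subr_ge0 (_ : _ - _ = (x - y - (y - u)) ^+ 2) ?sqr_ge0//; ring.
Qed.

End TranslationDefect.

Section EvenTranslations.
Variables (R : realFieldType) (T : finType) (g : {perm T} -> R) (z : T) (V : R).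
Hypothesis gV : forall i j, i != z -> j != z ->
  defect g (tperm j z * tperm i z)%g <= V.

(** A transposition (x y) is (x z)(y z)(x z), so its product with (i z) is a
    product of two pairs of transpositions at z. *)
Lemma defect_tperm2 x y i : i != z -> x != y ->
  defect g (tperm x y * tperm i z)%g <= 4 * V.
Proof.
move=> iz xy; have V0 : 0 <= V by apply: le_trans (gV iz iz); exact: defect_ge0.
have V4 : V <= 4 * V by lra.
have [xz|xz] := eqVneq x z.
  apply: le_trans V4; rewrite xz tpermC; apply: gV => //.
  by rewrite eq_sym -xz.
have [yz|yz] := eqVneq y z; first by rewrite yz; apply: le_trans V4; exact: gV.
have -> : tperm x y = (tperm x z * tperm y z * tperm x z)%g.
  have := tpermJ y z (tperm x z).
  rewrite tpermR tpermD 1?eq_sym// 1?eq_sym// conjgE tpermV => E.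
  by rewrite [LHS]tpermC -E !mulgA.
rewrite -mulgA; apply: le_trans (defectM _ _ _) _.
by have := gV yz xz; have := gV iz xz; lra.
Qed.

(** Write r as a product of at most #|B| transpositions and keep the parity in the
    extra factor (i z), so that each step multiplies by a product of two
    transpositions. Each step doubles the bound; the resulting factor 2 ^ #|B| is
    harmless because B stays fixed when T grows. *)
Lemma defect_even (B : {set T}) i r : i != z -> perm_on B r ->
  defect g (tperm i z ^+ odd_perm r * r)%g <= 8 * V * (2 ^ #|B|)%:R.
Proof.
move=> iz; have V0 : 0 <= V by apply: le_trans (gV iz iz); exact: defect_ge0.
suff H : forall k (B : {set T}) r, #|B| = k -> perm_on B r ->
    defect g (tperm i z ^+ odd_perm r * r)%g <= 8 * V * ((2 ^ k)%:R - 1).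
  move=> rB; apply: le_trans (H _ _ _ erefl rB) _.
  by rewrite ler_wpM2l ?mulr_ge0//; lra.
elim=> [|k IHk] {}B {}r cB rB.
  have -> : r = 1%g by apply: (perm_on_id rB); rewrite cB.
  by rewrite odd_perm1 mul1g defect1 subrr mulr0.
have /card_gt0P[x xB] : (0 < #|B|)%N by rewrite cB.
(* r' fixes x, and r is the product of (x y) and r'. *)
pose y := (r^-1)%g x; pose r' := (tperm x y * r)%g.
have yB : y \in B by rewrite perm_closed// perm_onV.
have r'B : perm_on (B :\ x)%SET r'.
  rewrite perm_on_fix// perm_onM ?perm_on_tperm//=.
  by rewrite permM tpermL /y permKV eqxx.
have cBx : #|(B :\ x)%SET| = k by have := cardsD1 x B; rewrite xB cB => -[].
have IH := IHk _ _ cBx r'B.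
have rE : r = (tperm x y * r')%g by rewrite /r' mulgA tperm2 mul1g.
have P2 : (1 : R) <= (2 ^ k)%:R by rewrite ler1n expn_gt0.
have step : 8 * V * ((2 ^ k)%:R - 1) <= 8 * V * ((2 ^ k.+1)%:R - 1).
  by rewrite ler_wpM2l ?mulr_ge0// expnS natrM; lra.
have [xy|xy] := eqVneq x y.
  by rewrite rE -xy tperm1 mul1g; apply: le_trans step.
have D2 := defect_tperm2 iz xy.
have fin : 2 * (4 * V + defect g (tperm i z ^+ odd_perm r' * r')%g) <= 8 * V * ((2 ^ k.+1)%:R - 1).
  apply: (@le_trans _ _ (2 * (4 * V + 8 * V * ((2 ^ k)%:R - 1)))).
    by rewrite ler_wpM2l// lerD2l.
  by rewrite expnS natrM; nra.
apply: le_trans fin.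
rewrite rE odd_mul_tperm xy addTb; case: (odd_perm r') => /=.
  rewrite expg0 mul1g expg1.
  have -> : (tperm x y * r' = (tperm x y * tperm i z) * (tperm i z * r'))%g.
    by rewrite -!mulgA (mulgA (tperm i z)) tperm2 mul1g.
  apply: le_trans (defectM _ _ _) _; by rewrite ler_wpM2l// lerD2r.
rewrite expg0 mul1g expg1 mulgA.
apply: le_trans (defectM _ _ _) _; rewrite ler_wpM2l// lerD2r.
by rewrite -defectV invMg !tpermV.
Qed.

End EvenTranslations.

Section InsertionInvariantCorrelation.
Variables (R : realFieldType) (T : finType) (g h : {perm T} -> R) (z : T) (V : R).
Variables (A B : {set T}).
Hypothesis gV : forall i j, i != z -> j != z ->
  defect g (tperm j z * tperm i z)%g <= V.
Hypothesis g1 : forall s, `|g s| <= 1.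
Hypothesis g0 : \sum_s g s = 0.
Hypothesis h1 : forall s, `|h s| <= 1.
Hypothesis hA : insertion_invariant A h.
Hypothesis AB : A \subset B.

Let N : R := ((#|T|)`!)%:R.

Lemma sum_perm_sign_eq0 : (1 < #|B|)%N -> \sum_(r | perm_on B r) perm_sign R r = 0.
Proof.
move=> /card_gt1P[x [y [xB yB xy]]].
suff E : \sum_(r | perm_on B r) perm_sign R r = - \sum_(r | perm_on B r) perm_sign R r by lra.
rewrite {1}(reindex_inj (mulgI (tperm x y))) -sumrN /=; apply: eq_big => r.
  apply/idP/idP => rB; last by rewrite perm_onM// perm_on_tperm.
  by rewrite -[r](mulKg (tperm x y)) tpermV perm_onM// perm_on_tperm.
by move=> _; rewrite perm_signM /perm_sign odd_tperm xy expr1 mulN1r.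
Qed.

(** Replacing g by its translate under an even permutation r of B costs at most the
    defect of r. Moving the translations to h and averaging over r turns h into a
    constant, up to the correction of sum_perm_sign_le, and g has mean 0. The
    weights 1 + perm_sign r select the even permutations. *)
Lemma insertion_invariant_correlation (lam : R) : 0 < lam -> (1 < #|B|)%N ->
  (exists i, i != z) ->
  \sum_s h s * g s <= (lam * N + 8 * V * (2 ^ #|B|)%:R / lam) / 2 +
     N * ((#|A| ^ 2)%:R / (#|B| * #|B|.-1)%:R).
Proof.
move=> lam0 B2 [i iz].
set E1 := (X in X + _); set E2 := (X in _ + N * X).
have b0 : 0 < ((#|B|)`!)%:R :> R by rewrite ltr0n fact_gt0.
have bb0 : 0 < (#|B| * #|B|.-1)%:R :> R by rewrite ltr0n; lia.
rewrite -(ler_pM2l b0).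
have sumw : ((#|B|)`!)%:R = \sum_(r | perm_on B r) (1 + perm_sign R r).
  by rewrite big_split /= sum_perm_sign_eq0// addr0 sumr_const card_perm.
have w0 r : 0 <= 1 + perm_sign R r.
  by rewrite /perm_sign; case: odd_perm; rewrite ?expr0 ?expr1; lra.
have main r : perm_on B r -> (1 + perm_sign R r) * (\sum_s h s * g s) <=
    (1 + perm_sign R r) * E1 + (1 + perm_sign R r) * \sum_s h (r^-1 * s)%g * g s.
  move=> rB; rewrite -mulrDr.
  have [od|ev] := boolP (odd_perm r); first by rewrite /perm_sign od expr1 subrr !mul0r.
  rewrite ler_wpM2l// -lerBlDr.
  have -> : \sum_s h (r^-1 * s)%g * g s = \sum_s h s * g (r * s)%g.
    by rewrite (reindex_inj (mulgI r)) /=; under eq_bigr do rewrite mulKg.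
  rewrite -sumrB.
  apply: (@le_trans _ _ (\sum_s (lam + (g (r * s)%g - g s) ^+ 2 / lam) / 2)).
    apply: ler_sum => s _; rewrite -mulrBr; move: (g (r * s)%g) => u.
    set d := u - g s; have -> : g s - u = - d by rewrite /d opprB.
    apply: (@le_trans _ _ `|d|).
      apply: le_trans (ler_norm _) _; rewrite normrM normrN.
      by rewrite -[leRHS]mul1r ler_wpM2r.
    rewrite -[d ^+ 2]real_normK ?num_real//; move: `|d| => e.
    rewrite ler_pdivlMr// -(ler_pM2r lam0) mulrDl divfK ?gt_eqF//.
    by rewrite -subr_ge0 (_ : _ - _ = (lam - e) ^+ 2) ?sqr_ge0//; ring.
  rewrite -mulr_suml ler_pM2r ?invr_gt0// big_split /= -mulr_suml -/(defect g r).
  rewrite sumr_const card_perm_type -[lam *+ _]mulr_natr lerD2l ler_pM2r ?invr_gt0//.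
  by have := defect_even gV iz rB; rewrite (negPf ev) expg0 mul1g.
rewrite {1}sumw mulr_suml; apply: le_trans (ler_sum _ main) _.
rewrite big_split /= -mulr_suml -sumw mulrDr lerD2l.
under eq_bigr do rewrite mulr_sumr.
rewrite exchange_big /=.
have cst s : \sum_(r | perm_on B r) (1 + perm_sign R r) * (h (r^-1 * s)%g * g s) <=
   (\sum_(r | perm_on B r) h r) * g s + ((#|B|)`!)%:R * E2.
  rewrite (reindex_inj invg_inj) /=.
  rewrite (eq_bigl (perm_on B)); last first.
    by move=> r; apply/idP/idP => rB; [rewrite -[r]invgK|]; exact: perm_onV.
  rewrite (eq_bigr (fun r => (h (r * s)%g + perm_sign R r * h (r * s)%g) * g s)); last first.
    by move=> r _; rewrite invgK /perm_sign odd_permV mulrDl mul1r mulrA -mulrDl.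
  rewrite -mulr_suml big_split /= mulrDl (sum_translate_const _ hA AB) lerD2l.
  apply: le_trans (ler_norm _) _; rewrite normrM (sum_perm_sign_translate_norm _ hA AB).
  apply: (@le_trans _ _ `|\sum_(r | perm_on B r) perm_sign R r * h r|).
    by rewrite -[leRHS]mulr1 ler_wpM2l.
  by rewrite /E2 mulrA -natrM ler_pdivlMr//; exact: sum_perm_sign_le.
apply: le_trans (ler_sum _ (fun s _ => cst s)) _.
rewrite big_split /= -mulr_sumr g0 mulr0 add0r sumr_const card_perm_type.
by rewrite -[_ *+ _]mulr_natr -/N le_eqVlt; apply/orP; left; apply/eqP; ring.
Qed.

End InsertionInvariantCorrelation.

Section LargestCycle.
Variables (R : realFieldType) (T : finType) (c : R).
Implicit Types (s : {perm T}) (A B : {set T}).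

(** With A the set of all points this is the event of interest; with a smaller A it
    is the estimate of this event from the sample A. *)
Definition large_orbit_in A s : bool :=
  [exists x, c * #|A|%:R <= #|porbit s x :&: A|%SET%:R].

Lemma large_orbit_insertion_invariant A : 0 < c -> A != set0%SET ->
  insertion_invariant A (fun s => (large_orbit_in A s)%:R : R).
Proof.
move=> c0 A0 s x d xA sx; congr (_ %:R); congr nat_of_bool.
have [->|dx] := eqVneq d x; first by rewrite tperm1 mulg1.
have eqI y : y != x -> (porbit (s * tperm x d)%g y :&: A = porbit s y :&: A)%SET.
  move=> yx; rewrite porbit_insert//; case: ifP => // _.
  apply/setP => u; rewrite !inE andb_orl; case: eqVneq => //= ->.
  by rewrite (negPf xA) !andbF.
apply/existsP/existsP => -[y yP].
- have [yx|yx] := eqVneq y x; last by exists y; rewrite -eqI.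
  exists d; rewrite -eqI//; move: yP; rewrite yx.
  suff -> : porbit (s * tperm x d)%g x = porbit (s * tperm x d)%g d by [].
  apply/eqP; rewrite eq_porbit_mem porbit_sym.
  have := porbit_closed (porbit_id (s * tperm x d)%g x).
  by rewrite permM sx tpermL.
- have [yx|yx] := eqVneq y x; last by exists y; rewrite eqI.
  move: yP; rewrite yx; have -> : (porbit s x :&: A = set0)%SET.
    apply/setP => u; rewrite !inE porbit_sym porbit_fixed//.
    by case: eqVneq => // <-; rewrite (negPf xA).
  rewrite cards0 leNgt mulr_gt0// ltr0n card_gt0 A0 //.
Qed.

(** The two events can differ only if some cycle length lies between a and b, or if
    the share of A in some cycle deviates by e from the share of T in it. The
    variances of these deviations add up to at most 1 / #|A| over all cycles. *)
Lemma card_large_mismatch A (e : R) (a b : nat) :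
  A != set0%SET -> 0 < e -> (0 < a)%N ->
  a%:R <= (c - e) * #|T|%:R -> (c + e) * #|T|%:R <= b%:R ->
  #|[set s : {perm T} | large_orbit_in [set: T] s != large_orbit_in A s]|%SET%:R <=
  ((#|T|)`!)%:R * ((b.+1 - a)%:R / a%:R + (#|A|%:R * e ^+ 2)^-1) :> R.
Proof.
move=> A0 e0 a0 ha hb; set m := #|A|; set n := #|T|.
have m0 : 0 < m%:R :> R by rewrite ltr0n card_gt0.
have n0 : 0 < n%:R :> R by rewrite ltr0n; apply: leq_trans (max_card A); rewrite card_gt0.
(* The w-mass of a cycle is the deviation of the share of A from that of T. *)
pose w x : R := (x \in A)%:R / m%:R - n%:R^-1.
have sumw (P : {set T}) : \sum_(x in P) w x = #|P :&: A|%SET%:R / m%:R - #|P|%:R / n%:R.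
  rewrite big_split /= -mulr_suml sumr_const mulNrn -[_ *+ #|P|]mulr_natl.
  congr (_ / _ - _); rewrite -sum1_card natr_sum [RHS]big_mkcond [LHS]big_mkcond /=.
  by apply: eq_bigr => x _; rewrite !inE; case: (x \in P); case: (x \in A).
have w0 : \sum_x w x = 0.
  have := sumw [set: T]%SET; rewrite setTI -/m cardsT -/n !divff ?gt_eqF// subrr.
  by move=> H; rewrite -[RHS]H; apply: eq_bigl => x; rewrite inE.
have w2 : \sum_x w x ^+ 2 <= m%:R^-1.
  have -> : \sum_x w x ^+ 2 = \sum_(x in A) w x / m%:R.
    transitivity (\sum_x w x * ((x \in A)%:R / m%:R) - (\sum_x w x) / n%:R).
      rewrite mulr_suml -sumrB; apply: eq_bigr => x _.
      by rewrite -mulrBr expr2.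
    rewrite w0 mul0r subr0 [RHS]big_mkcond; apply: eq_bigr => x _.
    by case: (x \in A); rewrite ?mul1r// mul0r mulr0.
  rewrite -mulr_suml sumw setIid -/m divff ?gt_eqF//.
  by apply: ler_piMl; rewrite ?invr_ge0 ?gerBl ?divr_ge0.
pose S1 := [set s : {perm T} | [exists x, (a <= #|porbit s x| <= b)%N]]%SET.
pose S2 := [set s : {perm T} | [exists x, e <= `|\sum_(i in porbit s x) w i|]]%SET.
have sub : [set s : {perm T} | large_orbit_in [set: T] s != large_orbit_in A s]%SET \subset (S1 :|: S2)%SET.
  apply/subsetP => s; rewrite !inE; apply: contraR.
  rewrite negb_or => /andP[/existsPn nW /existsPn nD].
  have dev x : `|#|porbit s x :&: A|%SET%:R / m%:R - #|porbit s x|%:R / n%:R| < e.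
    by rewrite -sumw ltNge nD.
  have nWx x : #|porbit s x|%:R < (c - e) * n%:R \/ (c + e) * n%:R < #|porbit s x|%:R.
    have := nW x; rewrite negb_and -!ltnNge => /orP[] H; [left|right].
      by apply: lt_le_trans ha; rewrite ltr_nat.
    by apply: le_lt_trans hb _; rewrite ltr_nat.
  apply/eqP; apply/existsP/existsP => -[x]; rewrite ?setIT ?cardsT -/n -/m => xP; exists x;
    rewrite ?setIT ?cardsT -/n -/m; have := dev x; rewrite ltr_distl => /andP[d1 d2].
  - have {d1} : #|porbit s x|%:R / n%:R < #|porbit s x :&: A|%SET%:R / m%:R + e by lra.
    have [H|H] := nWx x; first by nra.
    rewrite -ltr_pdivlMr// in H => d1; rewrite -ler_pdivlMr//; lra.
  - rewrite -ler_pdivlMr// in xP; have [H|H] := nWx x; last by nra.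
    by rewrite -ltr_pdivrMr// in H; lra.
apply: (@le_trans _ _ (#|S1|%:R + #|S2|%:R)).
  rewrite -natrD ler_nat; apply: leq_trans (subset_leq_card sub) _.
  by rewrite -cardsUI leq_addr.
rewrite mulrDr; apply: lerD.
  rewrite mulrA ler_pdivlMr ?ltr0n// -!natrM ler_nat [X in (_ <= X)%N]mulnC.
  exact: card_porbit_window.
rewrite ler_pdivlMr ?mulr_gt0 ?exprn_gt0// mulrCA -ler_pdivlMl//.
apply: le_trans (card_orbit_deviation w0 (ltW e0)) _.
by rewrite mulrC ler_wpM2r.
Qed.

Lemma large_correlation (g : {perm T} -> R) (z : T) (V : R) A B (e lam : R) (a b : nat) :
  0 < c ->
  (forall i j, i != z -> j != z -> defect g (tperm j z * tperm i z)%g <= V) ->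
  (forall s, `|g s| <= 1) -> \sum_s g s = 0 ->
  A != set0%SET -> A \subset B -> (1 < #|B|)%N -> 0 < e -> 0 < lam -> (0 < a)%N ->
  a%:R <= (c - e) * #|T|%:R -> (c + e) * #|T|%:R <= b%:R ->
  \sum_s (large_orbit_in [set: T] s)%:R * g s <=
  ((#|T|)`!)%:R * ((b.+1 - a)%:R / a%:R + (#|A|%:R * e ^+ 2)^-1 +
     (#|A| ^ 2)%:R / (#|B| * #|B|.-1)%:R + lam / 2) + 4 * V * (2 ^ #|B|)%:R / lam.
Proof.
move=> c0 gV g1 g0 A0 AB B2 e0 lam0 a0 ha hb.
have zz : exists i, i != z.
  case/card_gt1P: B2 => x [y [_ _ xy]]; have [xz|xz] := eqVneq x z; last by exists x.
  by exists y; rewrite eq_sym -xz.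
have h1 s : `|(large_orbit_in A s)%:R : R| <= 1 by case: large_orbit_in; rewrite ?normr0 ?normr1.
have H1 := insertion_invariant_correlation gV g1 g0 h1 (large_orbit_insertion_invariant c0 A0) AB lam0 B2 zz.
have H2 := card_large_mismatch A0 e0 a0 ha hb.
have H3 : \sum_s (large_orbit_in [set: T] s)%:R * g s <=
    \sum_s (large_orbit_in A s)%:R * g s +
    #|[set s : {perm T} | large_orbit_in [set: T] s != large_orbit_in A s]|%SET%:R.
  rewrite -sum1_card natr_sum [in X in _ + X]big_mkcond -big_split /=; apply: ler_sum => s _.
  have := g1 s; rewrite ler_norml inE => /andP[].
  by case: (large_orbit_in A s); case: (large_orbit_in _ s); rewrite /= ?mul0r ?mul1r; lra.
apply: le_trans H3 _; apply: le_trans (lerD H1 H2) _.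
move: (_ / a%:R) (_^-1) (_ / _%:R) => X1 X2 X3.
rewrite le_eqVlt; apply/orP; left; apply/eqP; field. by rewrite (gt_eqF e0) pnatr_eq0 cards_eq0 A0.
Qed.

End LargestCycle.

(** * Averaging over a generating set *)

Section Averaging.
Variables (R : realFieldType) (gT : finGroupType) (A : {set gT}).
Hypothesis A0 : A != set0%SET.
Hypothesis AV : forall s, s \in A -> (s^-1)%g \in A.
Implicit Types (f h : gT -> R) (s t x : gT).

Let a : R := #|A|%:R.

Lemma card_gen_gt0 : 0 < a.
Proof. by rewrite ltr0n card_gt0. Qed.

Definition averaging f x : R := a^-1 * \sum_(s in A) f (s * x)%g.

Definition dot f h : R := \sum_x f x * h x.

Lemma dot_ge0 f : 0 <= dot f f.
Proof. by apply: sumr_ge0 => x _; rewrite -expr2 sqr_ge0. Qed.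

Lemma dot_le_half f h : `|dot f h| <= (dot f f + dot h h) / 2.
Proof.
rewrite /dot -big_split mulr_suml; apply: le_trans (ler_norm_sum _ _ _) _.
apply: ler_sum => x _ /=; rewrite ler_norml; apply/andP; split.
  rewrite -subr_ge0 (_ : _ - _ = (f x + h x) ^+ 2 / 2) ?divr_ge0 ?sqr_ge0//.
  by field.
rewrite -subr_ge0 (_ : _ - _ = (f x - h x) ^+ 2 / 2) ?divr_ge0 ?sqr_ge0//.
by field.
Qed.

Lemma dot_avg f h : dot (averaging f) h = dot f (averaging h).
Proof.
rewrite /dot /averaging; under eq_bigr do rewrite -mulrA mulr_suml.
under [RHS]eq_bigr do rewrite mulrCA mulr_sumr.
rewrite -!mulr_sumr exchange_big [in RHS]exchange_big /=; congr (_ * _).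
rewrite [RHS](reindex_inj invg_inj) /=; apply: eq_big => s.
  by apply/idP/idP => [|/AV]; [exact: AV|rewrite invgK].
move=> _; rewrite [RHS](reindex_inj (mulgI s)) /=.
by apply: eq_bigr => x _; rewrite mulKg.
Qed.

Lemma dot_iter_avg k f h : dot (iter k averaging f) h = dot f (iter k averaging h).
Proof. by elim: k h => // k IHk h; rewrite iterS dot_avg IHk -iterSr. Qed.

Lemma sum_avg f : \sum_x averaging f x = \sum_x f x.
Proof.
rewrite -mulr_sumr exchange_big /= (eq_bigr (fun=> \sum_x f x)); last first.
  by move=> s _; rewrite [RHS](reindex_inj (mulgI s)).
by rewrite sumr_const -[_ *+ _]mulr_natl -/a mulKf// gt_eqF// card_gen_gt0.
Qed.

Lemma sum_iter_avg k f : \sum_x iter k averaging f x = \sum_x f x.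
Proof. by elim: k => // k IHk; rewrite iterS sum_avg. Qed.

Lemma avg_le f b : (forall x, `|f x| <= b) -> forall x, `|averaging f x| <= b.
Proof.
move=> fb x; rewrite /averaging normrM normfV (ger0_norm (ltW card_gen_gt0)) ler_pdivrMl ?card_gen_gt0//.
apply: le_trans (ler_norm_sum _ _ _) _.
by rewrite [a * b]mulr_natl -sumr_const; apply: ler_sum => s _.
Qed.

Lemma iter_avg_le k f b : (forall x, `|f x| <= b) -> forall x, `|iter k averaging f x| <= b.
Proof. by move=> fb; elim: k => // k IHk; apply: avg_le. Qed.

Lemma defect_dot f r : defect f r = 2 * dot f f - 2 * \sum_x f (r * x)%g * f x.
Proof.
have E : dot f f = \sum_x f (r * x)%g * f (r * x)%g.
  by rewrite /dot (reindex_inj (mulgI r)).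
rewrite [2 * dot f f]mulr_natl mulr2n {1}E /dot mulr_sumr -big_split -sumrB /=.
by apply: eq_bigr => x _; ring.
Qed.

(** The translations by products of two generators average to the square of the
    averaging operator. Single generators would not do: the averaging operator has
    the eigenvalue -1 on the sign when all generators are odd, and a slow
    iterate need not be almost invariant under them. *)
Lemma sum_defect f :
  \sum_(s in A) \sum_(t in A) defect f (s * t)%g =
  2 * a ^+ 2 * (dot f f - dot (averaging f) (averaging f)).
Proof.
under eq_bigr do under eq_bigr do rewrite defect_dot.
under eq_bigr do rewrite sumrB sumr_const -mulr_sumr.
rewrite sumrB sumr_const -mulr_sumr -mulrnA -[_ *+ _]mulr_natl natrM -/a.
rewrite -dot_avg {3}/dot /averaging.
have -> : \sum_x a^-1 * (\sum_(s in A) a^-1 * (\sum_(s0 in A) f (s0 * (s * x))%g)) * f x =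
    (a ^+ 2)^-1 * \sum_(s in A) \sum_(t in A) \sum_x f (s * t * x)%g * f x.
  rewrite [X in _ = _ * X]exchange_big /= [RHS]mulr_sumr.
  under [RHS]eq_bigr do rewrite exchange_big.
  under [RHS]eq_bigr do rewrite mulr_sumr.
  rewrite [RHS]exchange_big /=; apply: eq_bigr => x _.
  rewrite mulr_sumr mulr_suml; apply: eq_bigr => s _.
  rewrite !mulr_sumr ?mulr_suml; apply: eq_bigr => t _.
  by rewrite mulgA expr2 invfM !mulrA.
have := gt_eqF card_gen_gt0; set S := \sum_(s in A) _ => a0.
by field; rewrite a0.
Qed.

Lemma dot_avg_le f : dot (averaging f) (averaging f) <= dot f f.
Proof.
rewrite -subr_ge0 -(@pmulr_rge0 _ (2 * a ^+ 2)); last first.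
  by rewrite mulr_gt0// exprn_gt0// card_gen_gt0.
by rewrite -sum_defect sumr_ge0// => s _; rewrite sumr_ge0// => t _; apply: defect_ge0.
Qed.

Definition iter_sqnorm k f := dot (iter k averaging f) (iter k averaging f).

Lemma iter_sqnorm_noninc f k l : (k <= l)%N -> iter_sqnorm l f <= iter_sqnorm k f.
Proof.
move=> /subnK <-; elim: (l - k)%N => // d IHd; rewrite addSn.
by apply: le_trans IHd; rewrite /iter_sqnorm iterS dot_avg_le.
Qed.

Lemma iter_sqnormE f k : iter_sqnorm k f = dot f (iter (k + k) averaging f).
Proof. by rewrite /iter_sqnorm dot_iter_avg -iterD. Qed.

(** Half of the steps are moved to the other factor; an odd step is absorbed by
    contraction. *)
Lemma dot_iter_avg_le f k : `|dot f (iter k averaging f)| <= iter_sqnorm k./2 f.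
Proof.
rewrite -[in X in dot _ X](odd_double_half k) -addnn; case: (odd k); last first.
  by rewrite add0n -iter_sqnormE ger0_norm// dot_ge0.
rewrite add1n -addnS iterD -dot_iter_avg; apply: le_trans (dot_le_half _ _) _.
by rewrite iterS ler_pdivrMr// mulr_natr mulr2n lerD2l dot_avg_le.
Qed.

(** The squared norms of the iterates decrease from dot f f and stay nonnegative, so
    one of J disjoint decrements is at most a proportion 1 / J. The indices are
    even because iter_sqnormE expresses the norm at i as a correlation with the
    iterate at 2 i. *)
Lemma exists_slow_step f J : (0 < J)%N ->
  exists2 i, (i < J)%N & (iter_sqnorm i.*2 f - iter_sqnorm i.*2.+1 f) * J%:R <= dot f f.
Proof.
move=> J0; have [/existsP[i Hi]|/existsPn H] := boolP [exists i : 'I_J,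
    (iter_sqnorm i.*2 f - iter_sqnorm i.*2.+1 f) * J%:R <= dot f f].
  by exists i.
have tel k : \sum_(i < k) (iter_sqnorm i.*2 f - iter_sqnorm i.*2.+1 f) <= dot f f - iter_sqnorm k.*2 f.
  elim: k => [|k IHk]; first by rewrite big_ord0 subrr.
  rewrite big_ord_recr /=; have := @iter_sqnorm_noninc f k.*2.+1 k.+1.*2.
  rewrite doubleS => /(_ (leqnSn _)); lra.
have {}tel : \sum_(i < J) (iter_sqnorm i.*2 f - iter_sqnorm i.*2.+1 f) <= dot f f.
  by apply: le_trans (tel J) _; rewrite gerBl dot_ge0.
have : \sum_(i < J) dot f f / J%:R < \sum_(i < J) (iter_sqnorm i.*2 f - iter_sqnorm i.*2.+1 f).
  apply: ltr_sum => [|i _].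
    by apply/hasP; exists (Ordinal J0); rewrite ?mem_index_enum.
  by rewrite ltr_pdivrMr ?ltr0n// ltNge H.
rewrite sumr_const card_ord -[(_ / _) *+ _]mulr_natr divfK ?pnatr_eq0 -?lt0n//.
by move=> /lt_le_trans/(_ tel); rewrite ltxx.
Qed.

Lemma avg_conj f t : t \in 'N(A)%g -> (forall x, f (x ^ t)%g = f x) ->
  forall x, averaging f (x ^ t)%g = averaging f x.
Proof.
move=> tA ft x; rewrite /averaging (reindex_inj (conjg_inj t)) /=; congr (_ * _).
apply: eq_big => s; first by rewrite memJ_norm.
by move=> _; rewrite -conjMg ft.
Qed.

Lemma iter_avg_conj k f t : t \in 'N(A)%g -> (forall x, f (x ^ t)%g = f x) ->
  forall x, iter k averaging f (x ^ t)%g = iter k averaging f x.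
Proof. by move=> tA ft; elim: k => // k IHk; apply: avg_conj. Qed.

Lemma defectJ f r t : (forall x, f (x ^ t)%g = f x) ->
  defect f (r ^ t)%g = defect f r.
Proof.
move=> ft; rewrite /defect (reindex_inj (conjg_inj t)) /=.
by apply: eq_bigr => s _; rewrite -conjMg !ft.
Qed.

(** Some s has small average defect of s * u over the generators u, and
    conjugation by t1 or t2 preserves this average. The quotient of the two
    conjugates is the product of (s ^ t2) * u with the inverse of (s ^ t1) * u. *)
Lemma defect_conj_quotient f J : (0 < J)%N -> (forall x, `|f x| <= 1) ->
  exists2 i, (i < J)%N & exists2 s, s \in A &
  forall t1 t2, t1 \in 'N(A)%g -> t2 \in 'N(A)%g ->
    (forall x, f (x ^ t1)%g = f x) -> (forall x, f (x ^ t2)%g = f x) ->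
    defect (iter i.*2 averaging f) ((s ^ t2) * (s ^ t1)^-1)%g <= 8 * #|gT|%:R / J%:R.
Proof.
move=> J0 f1; have [i iJ Hi] := exists_slow_step f J0; exists i => //.
set g := iter i.*2 averaging f; have J0' : 0 < J%:R :> R by rewrite ltr0n.
have ff : dot f f <= #|gT|%:R.
  rewrite /dot -sum1_card natr_sum; apply: ler_sum => x _.
  by rewrite -[f x * f x]ger0_norm -?expr2 ?sqr_ge0// normrX expr_le1.
pose p s := \sum_(t in A) defect g (s * t)%g.
have tot : \sum_(s in A) p s <= 2 * a ^+ 2 * (#|gT|%:R / J%:R).
  rewrite sum_defect ler_wpM2l ?mulr_ge0 ?exprn_ge0 ?ler0n//.
  by rewrite ler_pdivlMr//; apply: le_trans ff; exact: Hi.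
(* A generator that does no worse than the average. *)
have [s sA ps] : exists2 s, s \in A & p s <= 2 * a * (#|gT|%:R / J%:R).
  have [/existsP[s /andP[sA ps]]|/existsPn H] :=
    boolP [exists s, (s \in A) && (p s <= 2 * a * (#|gT|%:R / J%:R))].
    by exists s.
  have : \sum_(s in A) 2 * a * (#|gT|%:R / J%:R) < \sum_(s in A) p s.
    apply: ltr_sum => [|s sA]; last by have := H s; rewrite sA /= ltNge.
    by have /set0Pn[s sA] := A0; apply/hasP; exists s; rewrite ?mem_index_enum.
  rewrite sumr_const -[_ *+ _]mulr_natl -/a => /lt_le_trans/(_ tot).
  by rewrite (_ : a * _ = 2 * a ^+ 2 * (#|gT|%:R / J%:R)) ?ltxx//; ring.
exists s => // t1 t2 t1A t2A ft1 ft2.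
have pJ t : t \in 'N(A)%g -> (forall x, f (x ^ t)%g = f x) -> p (s ^ t)%g = p s.
  move=> tA ft; rewrite /p (reindex_inj (conjg_inj t)) /=.
  apply: eq_big => u; first by rewrite memJ_norm.
  by move=> _; rewrite -conjMg defectJ//; apply: iter_avg_conj.
set d := defect _ _; suff : a * d <= a * (8 * #|gT|%:R / J%:R).
  by rewrite ler_pM2l// card_gen_gt0.
have -> : a * d = \sum_(u in A) d by rewrite sumr_const mulr_natl.
apply: (@le_trans _ _ (\sum_(u in A) 2 * (defect g (s ^ t2 * u)%g + defect g (s ^ t1 * u)%g))).
  apply: ler_sum => u _; rewrite -[X in _ <= _ * (_ + X)]defectV.
  apply: le_trans (defectM _ _ _); rewrite le_eqVlt /d; apply/orP; left; apply/eqP.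
  by congr defect; move: (s ^ t2)%g (s ^ t1)%g => x y; rewrite invMg mulgA mulgK.
rewrite -mulr_sumr big_split /= -!/(p _) !pJ//.
by rewrite -[8 * _ / _]mulrA; move: (#|gT|%:R / J%:R) ps => q ps; lra.
Qed.

End Averaging.

(** This is what the proof uses of the generators: quotients of two conjugates of a
    generator, by permutations that normalize G, give every product of two distinct
    transpositions at the centre z. *)
Definition reaches_star_pairs (T : finType) (G : {set {perm T}}) (z : T) : Prop :=
  forall s, s \in G -> forall i j, i != z -> j != z -> i != j ->
  exists t1 t2, [/\ t1 \in 'N(G)%g, t2 \in 'N(G)%g &
    ((s ^ t2) * (s ^ t1)^-1 = tperm j z * tperm i z)%g].

Section LargeCycleDecay.
Variables (R : realFieldType) (T : finType) (G : {set {perm T}}) (c : R) (z : T).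
Hypothesis G0 : G != set0%SET.
Hypothesis GV : forall s, s \in G -> (s^-1)%g \in G.
Hypothesis G3 : reaches_star_pairs G z.

Definition large_cycle (s : {perm T}) : R := (large_orbit_in c [set: T]%SET s)%:R.

Definition centered (s : {perm T}) : R :=
  large_cycle s - (\sum_x large_cycle x) / ((#|T|)`!)%:R.

Lemma large_cycleJ (s t : {perm T}) : large_cycle (s ^ t)%g = large_cycle s.
Proof.
congr (_ %:R); congr nat_of_bool; apply/existsP/existsP => -[x].
  rewrite -(permKV t x) setIT card_porbitJ => H.
  by exists (t^-1 x)%g; rewrite setIT.
by move=> H; exists (t x); rewrite setIT card_porbitJ -[porbit s x]setIT.
Qed.

Lemma centered_le1 s : `|centered s| <= 1.
Proof.
have N0 : 0 < ((#|T|)`!)%:R :> R by rewrite ltr0n fact_gt0.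
have m0 : 0 <= (\sum_x large_cycle x) / ((#|T|)`!)%:R by rewrite divr_ge0// sumr_ge0.
have m1 : (\sum_x large_cycle x) / ((#|T|)`!)%:R <= 1.
  rewrite ler_pdivrMr// mul1r -card_perm_type -sum1_card natr_sum.
  by apply: ler_sum => x _; rewrite /large_cycle; case: large_orbit_in.
rewrite ler_norml /centered; move: m0 m1; move: (_ / _) => m m0 m1.
by rewrite /large_cycle; case: large_orbit_in => /=; apply/andP; split; lra.
Qed.

Lemma sum_centered : \sum_s centered s = 0.
Proof.
have N0 : ((#|T|)`!)%:R != 0 :> R by rewrite pnatr_eq0 -lt0n fact_gt0.
by rewrite sumrB sumr_const card_perm_type -[_ *+ _]mulr_natr divfK// subrr.
Qed.

(** The squared norm is at most the correlation of the indicator with a slow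
    iterate, to which large_correlation applies. *)
Lemma iter_sqnorm_centered_le (A B : {set T}) (e lam : R) (a b J : nat) :
  0 < c -> (0 < J)%N ->
  A != set0%SET -> A \subset B -> (1 < #|B|)%N -> 0 < e -> 0 < lam -> (0 < a)%N ->
  a%:R <= (c - e) * #|T|%:R -> (c + e) * #|T|%:R <= b%:R ->
  iter_sqnorm G J centered <=
  ((#|T|)`!)%:R * ((b.+1 - a)%:R / a%:R + (#|A|%:R * e ^+ 2)^-1 +
     (#|A| ^ 2)%:R / (#|B| * #|B|.-1)%:R + lam / 2 + 32 * (2 ^ #|B|)%:R / (lam * J%:R)).
Proof.
move=> c0 J0 A0 AB B2 e0 lam0 a0 ha hb.
have [i iJ [s sG Hs]] := defect_conj_quotient G0 GV J0 centered_le1.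
set g := iter i.*2 (averaging G) centered in Hs.
have cJ t x : centered (x ^ t)%g = centered x by rewrite /centered large_cycleJ.
have V : forall i j, i != z -> j != z ->
    defect g (tperm j z * tperm i z)%g <= 8 * ((#|T|)`!)%:R / J%:R.
  move=> k l kz lz; have [->|kl] := eqVneq k l.
    by rewrite tperm2 defect1 divr_ge0// mulr_ge0.
  have [t1 [t2 [t1G t2G <-]]] := G3 sG kz lz kl.
  by rewrite -card_perm_type; apply: Hs.
have g1 x : `|g x| <= 1 by apply: iter_avg_le => //; exact: centered_le1.
have g0 : \sum_x g x = 0 by rewrite sum_iter_avg// sum_centered.
apply: le_trans (iter_sqnorm_noninc G0 GV centered (ltnW iJ)) _.
rewrite iter_sqnormE// addnn -/g.
have -> : dot centered g = \sum_x large_cycle x * g x.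
  rewrite /dot /centered; under eq_bigr do rewrite mulrBl.
  by rewrite sumrB -mulr_sumr g0 mulr0 subr0.
apply: le_trans (large_correlation c0 V g1 g0 A0 AB B2 e0 lam0 a0 ha hb) _.
set X1 := (b.+1 - a)%:R / a%:R; set X2 := (#|A|%:R * e ^+ 2)^-1.
set X3 := (#|A| ^ 2)%:R / _; rewrite le_eqVlt; apply/orP; left; apply/eqP; field.
by rewrite !gt_eqF ?ltr0n.
Qed.

End LargeCycleDecay.

(** * Star transpositions and s-cycles *)

Lemma sum_eq_pred1 (R : pzSemiRingType) (I : finType) (a : I) :
  \sum_x (x == a)%:R = 1 :> R.
Proof. by rewrite (bigD1 a)//= eqxx big1 ?addr0// => x /negPf ->. Qed.

Section OnePointFunctions.
Variables (R : realType) (n : nat) (A : {set 'S_n}).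
Implicit Types (s t : 'S_n).

(** Under the walk the point p^-1 x0 performs a walk of its own, and eigenfunctions
    of the latter lift. *)
Lemma eigenvalue_one_point (nu l : R) (phi : 'I_n -> R) (x0 : 'I_n) :
  phi x0 != 0 ->
  (forall w, \sum_(s in A) (phi (s^-1 w)%g - phi w) = - (l * phi w)) ->
  eigenvalue_of_opp (walk_generator nu A) (nu * l).
Proof.
move=> phi0 phiE; exists (fun p : 'S_n => phi (p^-1 x0)%g).
  by exists 1%g; rewrite invg1 perm1.
move=> p; rewrite /walk_generator -mulrN -mulrA; congr (_ * _).
rewrite -[l * _]opprK -phiE; congr (- _).
by apply: eq_bigr => s _; rewrite invMg permM.
Qed.

Hypothesis AJ : forall s t, s \in A -> (s ^ t)%g \in A.

Lemma conj_set_norm t : t \in 'N(A)%g.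
Proof. by rewrite inE; apply/subsetP => s /imsetP[u uA ->]; exact: AJ. Qed.

(** By conjugation invariance the number p of generators that send w to a given
    other point is the same for all pairs, and counting the moved points of all
    generators gives n (n - 1) p = m #|A|. Any phi of mean 0 is then an
    eigenfunction, with eigenvalue n p. *)
Lemma conj_set_eigenvalue (nu : R) (m : nat) : (1 < n)%N ->
  A != set0%SET -> (0 < m)%N ->
  (forall s, s \in A -> #|[set x | s x != x]%SET| = m) ->
  eigenvalue_of_opp (walk_generator nu A) (nu * (#|A|%:R * m%:R / n.-1%:R)).
Proof.
move=> n1 A0 m0 Am.
pose x0 := Ordinal (ltnW n1); pose x1 := Ordinal n1.
have x01 : x0 != x1 by [].
pose q (w z : 'I_n) : R := \sum_(s in A) (s^-1 w == z)%g%:R.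
set p := q x0 x1.
have qp w z : w != z -> q w z = p.
  move=> wz; have [t <- <-] := perm_pair x01 wz.
  rewrite /p /q (reindex_inj (conjg_inj t)) /=; apply: eq_big => s.
    by rewrite memJ_norm// conj_set_norm.
  by rewrite -conjVg permJ (inj_eq perm_inj).
have qw w : q w w = #|A|%:R - n.-1%:R * p.
  have : \sum_z q w z = #|A|%:R.
    rewrite exchange_big /= -sum1_card natr_sum; apply: eq_bigr => s _.
    rewrite (bigD1 (s^-1 w)%g)//= eqxx big1 ?addr0// => z.
    by rewrite eq_sym => /negPf ->.
  rewrite (bigD1 w)//= (eq_bigr (fun=> p)); last by move=> z; rewrite eq_sym; exact: qp.
  rewrite sumr_const => <-.
  have -> : #|[pred z | z != w]| = n.-1.
    by have := cardC1 w; rewrite card_ord.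
  by rewrite -[p *+ _]mulr_natl addrK.
have n0 : (0 < n%:R :> R) by rewrite ltr0n ltnW.
have n10 : (0 < n.-1%:R :> R) by rewrite ltr0n -subn1 subn_gt0.
have nE : n%:R = n.-1%:R + 1 :> R by rewrite -[in LHS](prednK (ltnW n1)) -natr1.
have pE : n%:R * p = #|A|%:R * m%:R / n.-1%:R.
  apply: (mulIf (x := n.-1%:R)); first by rewrite gt_eqF.
  rewrite divfK ?gt_eqF//.
  transitivity (\sum_(w : 'I_n) (#|A|%:R - q w w)).
    rewrite (eq_bigr (fun=> n.-1%:R * p)) => [|w _]; last by rewrite qw; ring.
    by rewrite sumr_const card_ord -[_ *+ n]mulr_natl; ring.
  rewrite sumrB sumr_const card_ord exchange_big /=.
  have E s : s \in A -> \sum_(w : 'I_n) (s^-1 w == w)%g%:R = n%:R - m%:R :> R.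
    move=> sA; rewrite -(Am s sA) -[in n%:R](card_ord n).
    rewrite -(cardsC [set x | s x != x]%SET) natrD addrAC subrr add0r.
    rewrite -sum1_card natr_sum [RHS]big_mkcond /=; apply: eq_bigr => w _.
    rewrite !inE negbK -[X in _ == X](permK s w) (inj_eq perm_inj) eq_sym.
    by case: eqP.
  rewrite (eq_bigr _ E) sumr_const -[(_ - _) *+ _]mulr_natl -[_ *+ n]mulr_natl; ring.
rewrite -pE; pose phi x : R := (x == x0)%:R - (x == x1)%:R.
have phi_sum : \sum_x phi x = 0 by rewrite sumrB !sum_eq_pred1 subrr.
apply: (@eigenvalue_one_point _ _ phi x0).
  by rewrite /phi eqxx (negPf x01) subr0 oner_eq0.
move=> w; rewrite sumrB sumr_const -[_ *+ _]mulr_natl.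
have -> : \sum_(s in A) phi (s^-1 w)%g = \sum_z q w z * phi z.
  under [RHS]eq_bigr do rewrite mulr_suml.
  rewrite exchange_big; apply: eq_bigr => s _ /=.
  rewrite (bigD1 (s^-1 w)%g)//= eqxx mul1r big1 ?addr0// => z.
  by rewrite eq_sym => /negPf ->; rewrite mul0r.
rewrite (bigD1 w)//= (eq_bigr (fun z => p * phi z)); last first.
  by move=> z; rewrite eq_sym => wz; rewrite qp.
rewrite -mulr_sumr; have -> : \sum_(z | z != w) phi z = - phi w.
  by have /eqP := phi_sum; rewrite (bigD1 w)//= addrC addr_eq0 => /eqP.
by rewrite qw nE; ring.
Qed.

End OnePointFunctions.

Section Star.
Variables (R : realType) (n : nat).

Let z : 'I_n.+2 := ord_max.
Let G := edge_transpositions (@star n.+2).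

Lemma star_transpositionP (s : 'S_n.+2) :
  reflect (exists2 i, i != z & s = tperm i z) (s \in G).
Proof.
have zE (j : 'I_n.+2) : (j.+1 == n.+2) = (j == z) by rewrite -val_eqE.
apply: (iffP imsetP) => [[[i j]]|[i iz ->]].
  rewrite inE => /andP[/= ij]; rewrite (zE i) (zE j) => /orP[] /eqP E ->.
    by exists j; rewrite -?E 1?eq_sym// tpermC.
  by exists i; rewrite -?E.
by exists (i, z) => //; rewrite inE; apply/andP; split => //=; rewrite (zE z) eqxx orbT.
Qed.

Lemma star_neq0 : G != set0%SET.
Proof.
by apply/set0Pn; exists (tperm ord0 z); apply/star_transpositionP; exists ord0.
Qed.

Lemma starV s : s \in G -> (s^-1)%g \in G.
Proof. by case/star_transpositionP => i iz ->; rewrite tpermV; apply/star_transpositionP; exists i. Qed.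

Lemma star_norm (t : 'S_n.+2) : t z = z -> t \in 'N(G)%g.
Proof.
move=> tz; rewrite inE; apply/subsetP => s /imsetP[u /star_transpositionP[i iz ->] ->].
apply/star_transpositionP; exists (t i); last by rewrite tpermJ tz.
by rewrite -tz (inj_eq perm_inj).
Qed.

Lemma star_reaches_star_pairs : reaches_star_pairs G z.
Proof.
move=> _ /star_transpositionP[k kz ->] i j iz jz ij.
exists (tperm k i), (tperm k j).
by rewrite !star_norm ?tpermD// !tpermJ !tpermL !tpermD// tpermV.
Qed.

Lemma card_star : #|G| = n.+1.
Proof.
have -> : G = [set tperm i z | i in [set~ z]]%SET.
  apply/setP => s; apply/star_transpositionP/imsetP => -[i iz ->]; exists i => //.
    by rewrite !inE.
  by move: iz; rewrite !inE.
rewrite card_in_imset ?cardsC1 ?card_ord// => i j _ _ /(congr1 (fun s : 'S_n.+2 => s z)).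
by rewrite !tpermR.
Qed.

Lemma star_eigenvalue (nu : R) : (0 < n)%N ->
  eigenvalue_of_opp (interchange_generator nu (@star n.+2)) (nu * 1).
Proof.
move=> n0; pose x0 : 'I_n.+2 := ord0; pose x1 : 'I_n.+2 := inord 1.
have x1E : x1 = 1%N :> nat by rewrite /x1 inordK.
have x01 : x0 != x1 by rewrite -val_eqE /= x1E.
have x0z : x0 != z by rewrite -val_eqE.
have x1z : x1 != z by rewrite -val_eqE /= x1E eqSS eq_sym -lt0n.
pose phi x : R := (x == x0)%:R - (x == x1)%:R.
(* phi has sum 0 and vanishes at the centre z, with which every other point is
   exchanged at the same rate. *)
apply: (@eigenvalue_one_point _ _ _ nu 1 phi x0).
  by rewrite /phi eqxx (negPf x01) subr0 oner_eq0.
have phiz : phi z = 0 by rewrite /phi ![z == _]eq_sym (negPf x0z) (negPf x1z) subr0.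
have phi_sum : \sum_x phi x = 0 by rewrite sumrB !sum_eq_pred1 subrr.
have sumG (F : 'S_n.+2 -> R) : \sum_(s in G) F s = \sum_(i | i != z) F (tperm i z).
  rewrite (reindex_onto (fun i => tperm i z) (fun s : 'S_n.+2 => s z)) /=; last first.
    by move=> s /star_transpositionP[i _ ->]; rewrite tpermR.
  apply: eq_bigl => i; rewrite tpermR eqxx andbT.
  apply/star_transpositionP/idP => [[j jz]|iz]; last by exists i.
  by move=> /(congr1 (fun s : 'S_n.+2 => s z)); rewrite !tpermR => ->.
move=> w; rewrite -/G sumG mul1r; have [->|wz] := eqVneq w z.
  rewrite phiz oppr0; under eq_bigr do rewrite tpermV tpermR addr0.
  by have := phi_sum; rewrite (bigD1 z)//= phiz add0r.
rewrite (bigD1 w)//= tpermV tpermL phiz sub0r big1 ?addr0// => i /andP[iz iw].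
by rewrite tpermV tpermD// 1?eq_sym// subrr.
Qed.

End Star.

Section Cycles.
Variables (R : realType) (n m : nat).
Hypothesis m1 : (1 < m)%N.

Let C := s_cycles n m.

Lemma s_cyclesP (s : 'S_n) :
  reflect (exists x, #|porbit s x| = m /\ perm_on (porbit s x) s) (s \in C).
Proof.
by rewrite inE; apply: (iffP existsP) => -[x]; [move=> /andP[/eqP]|move=> [/eqP e o]];
  exists x => //; rewrite e.
Qed.

Lemma s_cyclesJ s t : s \in C -> (s ^ t)%g \in C.
Proof.
case/s_cyclesP => x [sx sP]; apply/s_cyclesP; exists (t x); rewrite card_porbitJ; split=> //.
apply/subsetP => y; rewrite inE -(permKV t y) permJ (inj_eq perm_inj) porbitJ => H.
by apply: (subsetP sP); rewrite inE.
Qed.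

Lemma s_cyclesV s : s \in C -> (s^-1)%g \in C.
Proof.
by case/s_cyclesP => x [sx sP]; apply/s_cyclesP; exists x; rewrite porbitV perm_onV.
Qed.

Lemma s_cycles_support s : s \in C -> #|[set x | s x != x]%SET| = m.
Proof.
case/s_cyclesP => x [sx sP]; rewrite -sx; apply: eq_card => y; rewrite !inE.
apply/idP/idP => [H|yx]; first by apply: (subsetP sP); rewrite inE.
apply/negP => /eqP sy; move: yx m1; rewrite porbit_fixed// => /eqP yxE.
rewrite ltnNge -sx => /negP; apply; rewrite -(cards1 x).
apply: subset_leq_card; apply: porbit_sub; first by rewrite set11.
by move=> u; rewrite !inE => /eqP ->; rewrite -yxE sy.
Qed.

Lemma exists_single_cycle k : (0 < k <= n)%N ->
  exists (s : 'S_n) x, #|porbit s x| = k /\ perm_on (porbit s x) s.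
Proof.
case/andP; elim: k => // -[_ _ n0|k IHk _ kn].
  exists 1%g, (Ordinal n0); split; last exact: perm_on1.
  apply/eqP; rewrite eqn_leq; apply/andP; split; last by rewrite lt0n card_porbit_neq0.
  rewrite -(cards1 (Ordinal n0)); apply: subset_leq_card.
  by apply: porbit_sub => [|u]; rewrite !inE// perm1.
have [s [x [sx sP]]] := IHk isT (ltnW kn).
have /subsetPn[y _ yP] : ~~ ('I_n \subset porbit s x).
  by apply: contraL kn => /subset_leq_card; rewrite card_ord sx leqNgt.
have sy : s y = y by apply: out_perm yP.
have xy : x != y by apply: contraNneq yP => <-; exact: porbit_id.
exists (s * tperm y x)%g, x; rewrite porbit_insert// porbit_id cardsU1 yP sx; split=> //.
apply: perm_onM; first exact: subset_trans sP (subsetUr _ _).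
by apply: perm_on_tperm; rewrite !inE ?eqxx ?porbit_id ?orbT.
Qed.

Lemma s_cycles_neq0 : (m <= n)%N -> C != set0%SET.
Proof.
move=> mn; have [|s [x sx]] := @exists_single_cycle m; first by rewrite mn (ltnW m1).
by apply/set0Pn; exists s; apply/s_cyclesP; exists x.
Qed.

(** Conjugating s by (x b), where s moves x and fixes b, and dividing by s gives the
    product of (x b) and (y b), with y the preimage of x. A further conjugation
    moves x, y, b to j, i, z. *)
Lemma s_cycles_reach_star_pairs (z : 'I_n) : (m < n)%N -> reaches_star_pairs C z.
Proof.
move=> mn s sC i j iz jz ij; have sm := s_cycles_support sC.
have N t : t \in 'N(C)%g by apply: conj_set_norm; exact: s_cyclesJ.
have /card_gt0P[x] : (0 < #|[set x | s x != x]%SET|)%N by rewrite sm ltnW.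
rewrite inE => sx.
have /subsetPn[b _] : ~~ ('I_n \subset [set x | s x != x]%SET).
  by apply: contraL mn => /subset_leq_card; rewrite card_ord sm leqNgt.
rewrite inE negbK => /eqP sb.
pose y := (s^-1 x)%g.
have sy : s y = x by rewrite permKV.
have xy : x != y by apply: contraNneq sx => E; rewrite -{2}sy E.
have xb : x != b by apply: contraNneq sx => ->; rewrite sb.
have yb : y != b by apply: contraNneq xb => E; rewrite -sy E sb.
have ji : j != i by rewrite eq_sym.
have [t [tx ty tb]] := perm_triple xy yb xb ji iz jz.
exists t, (tperm x b * t)%g; split => //.
rewrite conjgM -conjVg -conjMg -tx -ty -tb -!tpermJ -conjMg; congr (_ ^ t)%g.
have sVb : (s^-1 b)%g = b by rewrite -{1}sb permK.
have := tpermJ x b s^-1%g; rewrite conjgE invgK -/y sVb => <-.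
by rewrite conjgE tpermV -!mulgA.
Qed.

End Cycles.

Local Open Scope classical_set_scope.

(** * The semigroup as a Poisson mixture of powers *)

Section PoissonMixture.
Variable R : realType.
Implicit Types (a b : R) (u : nat -> R).

Lemma series_exp_coeff_le a N : 0 <= a -> series (exp_coeff a) N <= expR a.
Proof.
move=> a0; apply: nondecreasing_cvgn_le; last exact: is_cvg_series_exp_coeff.
by apply: nondecreasing_series => i _ _; exact: exp_coeff_ge0.
Qed.

(** The tail is dominated by a ^ M / M! times the series of exp a, because
    i! M! divides (i + M)!. *)
Lemma exp_coeffN_tail a M : 0 <= a ->
  `|expR (- a) - series (exp_coeff (- a)) M| <= expR a * exp_coeff a M.
Proof.
move=> a0; rewrite {1}/expR.
have -> : limn (series (exp_coeff (- a))) - series (exp_coeff (- a)) M =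
    limn (fun P => series (exp_coeff (- a)) P - series (exp_coeff (- a)) M).
  apply/esym/cvg_lim => //; apply: cvgB; last exact: cvg_cst.
  exact: is_cvg_series_exp_coeff.
have cv : cvgn (fun P => series (exp_coeff (- a)) P - series (exp_coeff (- a)) M).
  by apply: is_cvgB; [exact: is_cvg_series_exp_coeff|exact: is_cvg_cst].
rewrite -lim_norm//; apply: limr_le; first exact: is_cvg_norm.
near=> P; have MP : (M <= P)%N by near: P; exact: nbhs_infty_ge.
rewrite sub_series_geq//; apply: le_trans (ler_norm_sum _ _ _) _.
rewrite -{1}[M]add0n -{1}(subnK MP) big_addn addnK.
apply: (@le_trans _ _ (series (exp_coeff a) (P - M)%N * exp_coeff a M)).
  rewrite /series /= mulr_suml !big_mkord; apply: ler_sum => i _.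
  rewrite /exp_coeff /= normrM normfV normrX normrN !ger0_norm//.
  rewrite exprD mulrACA ler_wpM2l ?mulr_ge0 ?exprn_ge0// -invfM -natrM.
  rewrite lef_pV2 ?posrE ?ltr0n ?muln_gt0 ?fact_gt0// ler_nat.
  by rewrite -(bin_fact (leq_addr M i)) addKn leq_pmull// bin_gt0 leq_addr.
by rewrite ler_wpM2r ?exp_coeff_ge0// series_exp_coeff_le.
Unshelve. all: by end_near. Qed.

Lemma sum_triangle (F : nat -> nat -> R) N :
  \sum_(k < N) \sum_(j < k.+1) F j (k - j)%N = \sum_(j < N) \sum_(i < N - j) F j i.
Proof.
elim: N => [|N IHN]; first by rewrite !big_ord0.
rewrite big_ord_recr /= IHN !big_ord_recr /= subSnn big_ord1 subnn.
rewrite addrA -big_split /=; congr (_ + _); apply: eq_bigr => j _.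
by rewrite subSn ?(ltnW (ltn_ord j))// big_ord_recr.
Qed.

(** The Cauchy product of exp (- a) with the series of general term u_j a ^ j / j!. *)
Definition cauchy_coeff a u k : R :=
  \sum_(j < k.+1) exp_coeff a j * u j * exp_coeff (- a) (k - j)%N.

(** The expectation of u at a Poisson variable of mean a, truncated to values below
    N. *)
Definition poisson_partial a u N : R :=
  expR (- a) * \sum_(j < N) exp_coeff a j * u j.

Lemma sum_exp_coeff_conv a N :
  \sum_(j < N.+1) exp_coeff a j * exp_coeff a (N - j)%N = exp_coeff (2 * a) N.
Proof.
rewrite /exp_coeff /= mulr_natl mulr2n exprDn mulr_suml.
apply: eq_bigr => j _; have jN : (j <= N)%N by rewrite -ltnS.
rewrite -[in RHS]exprD subnK// [LHS]mulrACA -exprD subnKC// -[in RHS]mulr_natr -mulrA; congr (_ * _).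
have f0 k : (k`!)%:R != 0 :> R by rewrite pnatr_eq0 -lt0n fact_gt0.
rewrite -(bin_fact jN) !natrM; field.
by rewrite !f0 pnatr_eq0 -lt0n bin_gt0 jN.
Qed.

(** The sums over the triangle j + i < N and over the strip j < N differ by tails of
    exp (- a); the bounds for these tails add up to a term of the series of
    exp (2 a). *)
Lemma cauchy_poisson_diff a b u N : 0 <= a -> 0 <= b -> (forall j, `|u j| <= b) ->
  `|series (cauchy_coeff a u) N - poisson_partial a u N| <=
  b * expR a * exp_coeff (2 * a) N.
Proof.
move=> a0 b0 ub; rewrite /series /= big_mkord /cauchy_coeff.
rewrite (sum_triangle (fun j i => exp_coeff a j * u j * exp_coeff (- a) i)).
rewrite /poisson_partial mulr_sumr -sumrB; apply: le_trans (ler_norm_sum _ _ _) _.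
rewrite -sum_exp_coeff_conv big_ord_recr mulrDr /=.
apply: (@le_trans _ _ (b * expR a * \sum_(j < N) exp_coeff a j * exp_coeff a (N - j)%N)).
  rewrite mulr_sumr; apply: ler_sum => j _.
  rewrite -mulr_sumr mulrC -mulrBl normrM normrM mulrC (ger0_norm (exp_coeff_ge0 _ _))//.
  rewrite distrC; have := exp_coeffN_tail (N - j)%N a0.
  rewrite /series /= big_mkord => H.
  apply: (@le_trans _ _ (exp_coeff a j * b * (expR a * exp_coeff a (N - j)%N))).
    have e0 := exp_coeff_ge0 j a0; apply: ler_pM => //; last by rewrite ler_wpM2l.
    exact: mulr_ge0.
  by rewrite le_eqVlt; apply/orP; left; apply/eqP; ring.
by rewrite lerDl; apply: mulr_ge0; [apply: mulr_ge0 => //; exact: expR_ge0|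
  apply: mulr_ge0; exact: exp_coeff_ge0].
Qed.

Lemma is_cvg_poisson_partial a b u : 0 <= a -> (forall j, `|u j| <= b) ->
  cvgn (poisson_partial a u).
Proof.
move=> a0 ub; apply: is_cvgM; first exact: is_cvg_cst.
have -> : (fun N => \sum_(j < N) exp_coeff a j * u j) = series (fun j => exp_coeff a j * u j).
  by apply/funext => N; rewrite /series /= big_mkord.
apply: normed_cvg.
apply: (@series_le_cvg _ _ (fun j => b * exp_coeff a j)) => [n|n|n|].
- exact: normr_ge0.
- by rewrite mulr_ge0 ?exp_coeff_ge0//; apply: le_trans (ub 0%N).
- by rewrite /= normrM (ger0_norm (exp_coeff_ge0 _ _))// mulrC ler_wpM2r ?exp_coeff_ge0.
have -> : series (fun j => b * exp_coeff a j) = (fun N => b * series (exp_coeff a) N).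
  by apply/funext => N; rewrite /series /= mulr_sumr.
by apply: is_cvgM; [exact: is_cvg_cst|exact: is_cvg_series_exp_coeff].
Qed.

Lemma lim_cauchy_poisson a b u : 0 <= a -> 0 <= b -> (forall j, `|u j| <= b) ->
  poisson_partial a u @ \oo --> limn (series (cauchy_coeff a u)).
Proof.
move=> a0 b0 ub; have cv := is_cvg_poisson_partial a0 ub.
suff -> : limn (series (cauchy_coeff a u)) = limn (poisson_partial a u) by [].
apply/cvg_lim => //.
have -> : series (cauchy_coeff a u) =
    (fun N => (series (cauchy_coeff a u) N - poisson_partial a u N) + poisson_partial a u N).
  by apply/funext => N; rewrite subrK.
rewrite -[limn (poisson_partial a u)]add0r; apply: cvgD => //.
apply/norm_cvg0P; apply: (@squeeze_cvgr _ _ _ _ (fun=> 0) (fun N => b * expR a * exp_coeff (2 * a) N)).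
- by near=> N; rewrite normr_ge0 /=; exact: cauchy_poisson_diff.
- exact: cvg_cst.
- rewrite -(mulr0 (b * expR a)); apply: cvgM; [exact: cvg_cst|exact: cvg_exp_coeff].
Unshelve. all: by end_near. Qed.

Lemma poisson_weight_le a j : 0 < a -> expR (- a) * exp_coeff a j <= j.+1%:R / a.
Proof.
move=> a0; rewrite ler_pdivlMr// expRN -mulrA mulrC ler_pdivrMr ?expR_gt0//.
rewrite /exp_coeff /=.
apply: (@le_trans _ _ (j.+1%:R * (a ^+ j.+1 / (j.+1)`!%:R))).
  rewrite exprS factS natrM invfM le_eqVlt; apply/orP; left; apply/eqP.
  have f0 k : (k`!)%:R != 0 :> R by rewrite pnatr_eq0 -lt0n fact_gt0.
  by field; rewrite f0 nat1r pnatr_eq0.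
rewrite ler_wpM2l//; apply: le_trans (expR_ge1Dxn j (ltW a0)).
by rewrite lerDr.
Qed.

(** A Poisson variable of large mean a is below K with probability at most
    K ^ 2 / a. *)
Lemma poisson_partial_le a u N K (k : R) : 0 < a -> 0 <= k ->
  (forall j, `|u j| <= 1) -> (forall j, (K <= j)%N -> `|u j| <= k) ->
  `|poisson_partial a u N| <= (K ^ 2)%:R / a + k.
Proof.
move=> a0 k0 u1 uk; rewrite /poisson_partial normrM (ger0_norm (expR_ge0 _)).
have w0 j : 0 <= exp_coeff a j by apply/exp_coeff_ge0/ltW.
apply: (@le_trans _ _ (expR (- a) * \sum_(j < N) (exp_coeff a j * (j < K)%N%:R + exp_coeff a j * k))).
  rewrite ler_wpM2l ?expR_ge0//; apply: le_trans (ler_norm_sum _ _ _) _.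
  apply: ler_sum => j _; rewrite normrM (ger0_norm (w0 j)) -mulrDr ler_wpM2l//.
  have [jK|jK] := ltnP j K; first by apply: le_trans (u1 j) _; rewrite lerDl.
  by rewrite add0r uk.
rewrite big_split /= mulrDr; apply: lerD; last first.
  rewrite -mulr_suml mulrA -[leRHS]mul1r ler_wpM2r// -(expRxMexpNx_1 a) mulrC.
  rewrite ler_wpM2r ?expR_ge0//; have := @series_exp_coeff_le a N (ltW a0).
  by rewrite /series /= big_mkord.
rewrite mulr_sumr; apply: (@le_trans _ _ (\sum_(j < K) expR (- a) * exp_coeff a j)).
  rewrite -(big_mkord predT (fun j => expR (- a) * (exp_coeff a j * (j < K)%N%:R))).
  rewrite -(big_mkord predT (fun j => expR (- a) * exp_coeff a j)).
  apply: (@le_trans _ _ (\sum_(0 <= j < maxn N K) expR (- a) * (exp_coeff a j * (j < K)%N%:R))).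
    rewrite [leRHS](@big_cat_nat _ _ _ N)//= ?leq_maxl// lerDl sumr_ge0// => j _.
    by rewrite mulr_ge0 ?expR_ge0// mulr_ge0.
  rewrite [leLHS](@big_cat_nat _ _ _ K)//= ?leq_maxr// [X in _ + X]big1_seq ?addr0.
    by apply: ler_sum => j _; case: ltnP => _; rewrite ?mulr1// !mulr0 mulr_ge0 ?expR_ge0.
  by move=> j; rewrite mem_index_iota => /and3P[_ + _]; rewrite leqNgt => /negPf ->; rewrite !mulr0.
apply: (@le_trans _ _ (\sum_(j < K) K%:R / a)).
  apply: ler_sum => j _; apply: le_trans (poisson_weight_le j a0) _.
  by rewrite ler_wpM2r ?invr_ge0 ?(ltW a0)// ler_nat.
by rewrite sumr_const card_ord -[(_ / _) *+ _]mulr_natl mulrA -natrM mulnn.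
Qed.

End PoissonMixture.

(** * Covariances along the chain *)

(** The expectation of a (X 0) * b (X t) for a chain X with initial law mu. *)
Definition two_time_law (R : realType) (S : finType) (Q : (S -> R) -> S -> R)
    (mu : S -> R) (t : R) (a b : S -> R) : R :=
  \sum_x \sum_y a x * b y * (mu x * transition Q t x y).

Section FiniteLaws.
Variables (R : realType) (d : measure_display) (Omega : measurableType d).
Variable P : probability Omega R.

Lemma measurable_finite_valued (I : finType) (Y : Omega -> I) (p : pred I) :
  (forall i, measurable (Y @^-1` [set i])) -> measurable [set w | p (Y w)].
Proof.
move=> mY; have -> : [set w | p (Y w)] = \bigcup_(i in [set i | p i]) Y @^-1` [set i].
  by apply/seteqP; split => [w /= pY|w [i /= pi ->//]]; exists (Y w).
by apply: fin_bigcup_measurable => //; exact: finite_finset.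
Qed.

Lemma probability_finite_valued (I : finType) (Y : Omega -> I) (p : pred I) :
  (forall i, measurable (Y @^-1` [set i])) ->
  P [set w | p (Y w)] = (\sum_(i | p i) P (Y @^-1` [set i]))%E.
Proof.
move=> mY; have -> : [set w | p (Y w)] = \bigcup_(i in [set` enum p]) Y @^-1` [set i].
  apply/seteqP; split => [w /= pY|w [i /= pi ->]].
    by exists (Y w) => //=; rewrite mem_enum.
  by move: pi; rewrite mem_enum.
rewrite measure_fin_bigcup//.
- by rewrite -fsbig_seq ?enum_uniq// big_enum.
- by move=> i j _ _ [w [/= iw jw]]; rewrite -iw -jw.
Qed.

Lemma covariance_indicators (f g : Omega -> bool) :
  measurable [set w | f w] -> measurable [set w | g w] ->
  covariance P (fun w => (f w)%:R) (fun w => (g w)%:R) =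
  (P [set w | f w && g w] - P [set w | f w] * P [set w | g w])%E.
Proof.
move=> mf mg.
have E (h : Omega -> bool) : (fun w => (h w)%:R : R) = \1_[set w | h w].
  apply/funext => w; rewrite indicE; congr (_%:R); congr nat_of_bool.
  by apply/idP/idP => [/(@mem_set _ [set w | h w])|/set_mem].
have L h : measurable [set w | h w] -> (\1_[set w | h w] : Omega -> R) \in Lfun P 1.
  by move=> mh; apply/Lfun1_integrable; exact: integrable_indic.
have fgE : [set w | f w && g w] = [set w | f w] `&` [set w | g w].
  by apply/seteqP; split => w /= /andP.
have mfg : measurable [set w | f w && g w] by rewrite fgE; exact: measurableI.
have prod : (\1_[set w | f w] * \1_[set w | g w] : Omega -> R) = \1_[set w | f w && g w].
  by rewrite fgE indicI.
rewrite !E covarianceE ?prod ?L// !expectation_indic//.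
Qed.

Lemma markov_chain_covariance (S : finType) (Q : (S -> R) -> S -> R) (mu : S -> R)
    (X : R -> Omega -> S) (t : R) (f : S -> bool) : 0 <= t ->
  is_markov_chain P Q mu X ->
  let law := two_time_law Q mu t in
  let f' x := (f x)%:R in
  covariance P (fun w => (f (X 0 w))%:R) (fun w => (f (X t w))%:R) =
  (law f' f' - law f' (fun=> 1) * law (fun=> 1) f')%:E.
Proof.
move=> t0 [mX lawX] law f'.
pose Y w := (X 0 w, X t w).
have mY i : measurable (Y @^-1` [set i]).
  have -> : Y @^-1` [set i] = X 0 @^-1` [set i.1] `&` X t @^-1` [set i.2].
    by apply/seteqP; split => w /=; rewrite /Y; [move=> <-|case: i => i1 i2 /= [-> ->]].
  by apply: measurableI; exact: mX.
have PY i : P (Y @^-1` [set i]) = (mu i.1 * transition Q t i.1 i.2)%:E.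
  have := lawX 1%N (fun k => if k == 0%N then 0 else t) (fun k => if k == 0%N then i.1 else i.2) erefl.
  rewrite /= big_ord1 /= subr0 => <-.
    congr (P _); apply/seteqP; split => w /=.
      by rewrite /Y => <- [|[|k]].
    move=> H; have /= := H 0%N isT; have /= := H 1%N isT.
    by rewrite /Y; case: i H => i1 i2 /= _ -> ->.
  by move=> [|k] [|l].
have PE (p : pred (S * S)) : P [set w | p (Y w)] =
    (\sum_x \sum_y (p (x, y))%:R * (mu x * transition Q t x y))%:E.
  rewrite probability_finite_valued// big_mkcond /=.
  rewrite pair_big /= -sumEFin; apply: eq_bigr => -[x y] _ /=; rewrite PY.
  by case: (p _); rewrite ?mul1r ?mul0r.
have mf s : 0 <= s -> measurable [set w | f (X s w)].
  by move=> s0; apply: measurable_finite_valued => x; exact: mX.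
rewrite (covariance_indicators (mf 0 (lexx 0)) (mf t t0)).
have E1 : P [set w | f (X 0 w)] = (law f' (fun=> 1))%:E.
  rewrite (PE (fun i => f i.1)); congr (_%:E).
  by apply: eq_bigr => x _; apply: eq_bigr => y _; rewrite mulr1.
have E2 : P [set w | f (X t w)] = (law (fun=> 1) f')%:E.
  rewrite (PE (fun i => f i.2)); congr (_%:E).
  by apply: eq_bigr => x _; apply: eq_bigr => y _; rewrite mul1r.
have E3 : P [set w | f (X 0 w) && f (X t w)] = (law f' f')%:E.
  rewrite (PE (fun i => f i.1 && f i.2)); congr (_%:E).
  by apply: eq_bigr => x _; apply: eq_bigr => y _; rewrite /f' -natrM mulnb.
by rewrite E1 E2 E3 -EFinM -EFinB.
Qed.

End FiniteLaws.

Section WalkSemigroup.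
Variables (R : realType) (gT : finGroupType) (A : {set gT}).
Implicit Types (f h : gT -> R) (x y : gT).

Lemma avgB f h x : averaging A (fun y => f y - h y) x = averaging A f x - averaging A h x.
Proof. by rewrite /averaging sumrB mulrBr. Qed.

Lemma avgZ r f x : averaging A (fun y => r * f y) x = r * averaging A f x.
Proof. by rewrite /averaging -mulr_sumr mulrCA. Qed.

Lemma iter_avgB k f h x :
  iter k (averaging A) (fun y => f y - h y) x = iter k (averaging A) f x - iter k (averaging A) h x.
Proof.
elim: k x => // k IHk x; rewrite !iterS -avgB; congr (averaging A _ x).
by apply/funext => y; rewrite IHk.
Qed.

Lemma iter_avgZ k r f x : iter k (averaging A) (fun y => r * f y) x = r * iter k (averaging A) f x.
Proof.
elim: k x => // k IHk x; rewrite !iterS -avgZ; congr (averaging A _ x).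
by apply/funext => y; rewrite IHk.
Qed.

Lemma iter_avg_sum k (I : finType) (a : I -> R) (F : I -> gT -> R) x :
  iter k (averaging A) (fun y => \sum_i a i * F i y) x = \sum_i a i * iter k (averaging A) (F i) x.
Proof.
elim: k x => // k IHk x; rewrite iterS.
have -> : iter k (averaging A) (fun y => \sum_i a i * F i y) =
    fun y => \sum_i a i * iter k (averaging A) (F i) y.
  by apply/funext => y; rewrite IHk.
rewrite /averaging exchange_big /= mulr_sumr; apply: eq_bigr => i _.
by rewrite -mulr_sumr mulrCA.
Qed.

(** The recurrence is the derivative, with respect to the parameter, of the product
    of exp (- a) and the exponential generating function of u. *)
Lemma cauchy_coeffS (a : R) u k :
  k.+1%:R * cauchy_coeff a u k.+1 =
  a * (cauchy_coeff a (fun j => u j.+1) k - cauchy_coeff a u k).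
Proof.
have eS b j : j.+1%:R * exp_coeff b j.+1 = b * exp_coeff b j :> R.
  rewrite /exp_coeff /= exprS factS natrM invfM.
  have f0 : (j`!)%:R != 0 :> R by rewrite pnatr_eq0 -lt0n fact_gt0.
  by field; rewrite f0 nat1r pnatr_eq0.
rewrite mulrBr; have -> : k.+1%:R * cauchy_coeff a u k.+1 =
    \sum_(j < k.+2) (j%:R * exp_coeff a j) * u j * exp_coeff (- a) (k.+1 - j)%N +
    \sum_(j < k.+2) exp_coeff a j * u j * ((k.+1 - j)%N%:R * exp_coeff (- a) (k.+1 - j)%N).
  rewrite /cauchy_coeff mulr_sumr -big_split /=; apply: eq_bigr => j _.
  by rewrite natrB ?leq_ord//; ring.
congr (_ + _).
  rewrite big_ord_recl /= !mul0r add0r /cauchy_coeff mulr_sumr; apply: eq_bigr => j _.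
  by rewrite /bump /= add1n eS subSS; ring.
rewrite big_ord_recr /= subnn mul0r mulr0 addr0 /cauchy_coeff mulr_sumr -sumrN.
apply: eq_bigr => j _; have jk : (j <= k)%N by rewrite -ltnS.
by rewrite subSn// eS; ring.
Qed.

Hypothesis A0 : A != finset.set0.
Variable nu : R.

Definition translation_generator f x : R := nu * \sum_(s in A) (f (s * x)%g - f x).

Lemma translation_generatorE f x : translation_generator f x = nu * #|A|%:R * (averaging A f x - f x).
Proof.
have a0 := card_gen_gt0 R A0.
rewrite /translation_generator /averaging sumrB sumr_const -[_ *+ _]mulr_natl; field; by rewrite gt_eqF.
Qed.

(** With K the averaging operator and r = nu #|A|, this is the coefficientwise form of
    exp (t r (K - 1)) = exp (- t r) exp (t r K). *)
Lemma exp_coeff_iter_generator (t : R) k f x :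
  exp_coeff t k * iter k translation_generator f x =
  cauchy_coeff (nu * #|A|%:R * t) (fun j => iter j (averaging A) f x) k.
Proof.
set r := nu * #|A|%:R; elim: k f => [|k IHk] f.
  by rewrite /cauchy_coeff big_ord1 /exp_coeff /= !expr0 fact0 invr1; ring.
have k0 : k.+1%:R != 0 :> R by rewrite pnatr_eq0.
apply: (mulfI k0); rewrite cauchy_coeffS iterSr.
have -> : k.+1%:R * (exp_coeff t k.+1 * iter k translation_generator (translation_generator f) x) =
   t * (exp_coeff t k * iter k translation_generator (translation_generator f) x).
  rewrite /exp_coeff /= exprS factS natrM invfM.
  have f0 : (k`!)%:R != 0 :> R by rewrite pnatr_eq0 -lt0n fact_gt0.
  by field; rewrite f0 nat1r.
rewrite IHk [r * t]mulrC -mulrA; congr (_ * _).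
rewrite /cauchy_coeff -sumrB mulr_sumr; apply: eq_bigr => j _.
have -> : iter j (averaging A) (translation_generator f) x =
    r * (iter j.+1 (averaging A) f x - iter j (averaging A) f x).
  rewrite iterSr -iter_avgB -iter_avgZ; congr (iter j _ _ x).
  by apply/funext => y; rewrite translation_generatorE.
by ring.
Qed.

End WalkSemigroup.

Section CovarianceBound.
Variables (R : realType) (gT : finGroupType) (A : {set gT}).
Hypothesis A0 : A != finset.set0.
Hypothesis AV : forall s, s \in A -> (s^-1)%g \in A.
Variables (nu t : R).
Hypothesis nu0 : 0 < nu.
Hypothesis t0 : 0 < t.
Implicit Types (f h : gT -> R) (x y : gT).

Let law := two_time_law (translation_generator A nu) (uniform_dist R gT) t.
Let r : R := nu * #|A|%:R * t.
Let N : R := #|gT|%:R.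

Lemma jump_rate_gt0 : 0 < r.
Proof. by rewrite !mulr_gt0// card_gen_gt0. Qed.

Lemma card_group_gt0 : 0 < N.
Proof. by rewrite ltr0n; apply/card_gt0P; exists 1%g. Qed.

Lemma poisson_partial_transition x y :
  poisson_partial r (fun j => iter j (averaging A) (fun z => (z == y)%:R) x) @ \oo -->
  transition (translation_generator A nu) t x y.
Proof.
rewrite /transition /semigroup.
have -> : (fun k => exp_coeff t k * iter k (translation_generator A nu) (fun z : gT => (z == y)%:R) x) =
    cauchy_coeff r (fun j => iter j (averaging A) (fun z => (z == y)%:R) x).
  by apply/funext => k; rewrite exp_coeff_iter_generator.
apply: (@lim_cauchy_poisson _ _ 1) => //; first exact: ltW jump_rate_gt0.
move=> j; apply: iter_avg_le => // z.
by case: (_ == _); rewrite ?normr1 ?normr0.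
Qed.

Lemma cvg_sum_seq (I : Type) (s : seq I) (u : I -> nat -> R) (l : I -> R) :
  (forall i, u i @ \oo --> l i) ->
  (fun n => \sum_(i <- s) u i n) @ \oo --> \sum_(i <- s) l i.
Proof.
move=> ul; elim: s => [|i s IHs].
  by rewrite big_nil; under eq_fun do rewrite big_nil; exact: cvg_cst.
by rewrite big_cons; under eq_fun do rewrite big_cons; apply: cvgD.
Qed.

Lemma poisson_partial_law f h :
  poisson_partial r (fun j => dot f (iter j (averaging A) h) / N) @ \oo -->
  law f h.
Proof.
have -> : poisson_partial r (fun j => dot f (iter j (averaging A) h) / N) =
   (fun n => \sum_x \sum_y f x * h y * (N^-1 *
      poisson_partial r (fun j => iter j (averaging A) (fun z => (z == y)%:R) x) n)).
  apply/funext => n; rewrite /poisson_partial.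
  under [RHS]eq_bigr do under eq_bigr do rewrite !mulr_sumr.
  under [RHS]eq_bigr do rewrite exchange_big /=.
  rewrite [RHS]exchange_big /= mulr_sumr; apply: eq_bigr => j _.
  have hE : h = fun z => \sum_y h y * (z == y)%:R.
    apply/funext => z; rewrite (bigD1 z)//= eqxx mulr1 big1 ?addr0// => y.
    by rewrite eq_sym => /negPf ->; rewrite mulr0.
  have avgE x : iter j (averaging A) h x = \sum_y h y * iter j (averaging A) (fun z => (z == y)%:R) x.
    by rewrite [in LHS]hE (iter_avg_sum A j h (fun y z => (z == y)%:R)).
  have -> : dot f (iter j (averaging A) h) =
      \sum_x \sum_y f x * (h y * iter j (averaging A) (fun z => (z == y)%:R) x).
    by apply: eq_bigr => x _; rewrite avgE mulr_sumr.
  rewrite mulr_suml !mulr_sumr; apply: eq_bigr => x _.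
  rewrite mulr_suml !mulr_sumr; apply: eq_bigr => y _; ring.
apply: cvg_sum_seq => x; apply: cvg_sum_seq => y.
apply: cvgM; first exact: cvg_cst.
by apply: cvgM; [exact: cvg_cst|exact: poisson_partial_transition].
Qed.

Lemma poisson_partial_cst (c : R) : poisson_partial r (fun=> c) @ \oo --> c.
Proof.
have -> : poisson_partial r (fun=> c) = (fun n => expR (- r) * (series (exp_coeff r) n * c)).
  by apply/funext => n; rewrite /poisson_partial /series /= mulr_suml big_mkord.
have E : c = expR (- r) * (expR r * c) by rewrite mulrA [expR _ * expR _]mulrC expRxMexpNx_1 mul1r.
rewrite [X in _ --> X]E; apply: cvgM; first exact: cvg_cst.
by apply: cvgM; [exact: is_cvg_series_exp_coeff|exact: cvg_cst].
Qed.

Lemma poisson_partialB u v n :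
  poisson_partial r (fun j => u j - v j) n = poisson_partial r u n - poisson_partial r v n.
Proof.
rewrite /poisson_partial -mulrBr -sumrB; congr (_ * _).
by apply: eq_bigr => j _; rewrite mulrBr.
Qed.

Lemma iter_avg_cst k (c : R) x : iter k (averaging A) (fun=> c) x = c.
Proof.
elim: k x => // k IHk x; rewrite iterS /averaging (eq_bigr (fun=> c)) => [|s _]; last exact: IHk.
by rewrite sumr_const -[c *+ _]mulr_natl mulKf// gt_eqF// card_gen_gt0.
Qed.

(** The left-hand side is the Poisson mixture of the normalized correlations of the
    centred f with its iterates (poisson_partial_law). A correlation with at least
    2 J steps is at most the squared norm after J steps. *)
Lemma covariance_law_le (f : gT -> R) (J : nat) :
  (forall x, 0 <= f x <= 1) ->
  `|law f f - law f (fun=> 1) * law (fun=> 1) f| <=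
  (J.*2 ^ 2)%:R / r + iter_sqnorm A J (fun x => f x - (\sum_x f x) / N) / N.
Proof.
move=> f01; set m := (\sum_x f x) / N; have N0 := card_group_gt0; have NN : N != 0 by rewrite gt_eqF.
have law_uniq a b l : (poisson_partial r (fun j => dot a (iter j (averaging A) b) / N) @ \oo --> l) ->
    law a b = l.
  by move=> H; rewrite -(cvg_lim (@Rhausdorff R) H); apply/esym/cvg_lim => //; exact: poisson_partial_law.
have l1 : law f (fun=> 1) = m.
  apply: law_uniq; have -> : (fun j => dot f (iter j (averaging A) (fun=> 1)) / N) = (fun=> m).
    apply/funext => j; congr (_ / _); apply: eq_bigr => x _.
    by rewrite iter_avg_cst mulr1.
  exact: poisson_partial_cst.
have l2 : law (fun=> 1) f = m.
  apply: law_uniq; have -> : (fun j => dot (fun=> 1) (iter j (averaging A) f) / N) = (fun=> m).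
    apply/funext => j; congr (_ / _); rewrite /dot; under eq_bigr do rewrite mul1r.
    by rewrite sum_iter_avg.
  exact: poisson_partial_cst.
set F := fun x => f x - m.
have F0 : \sum_x F x = 0.
  by rewrite sumrB sumr_const -[_ *+ _]mulr_natr -/N divfK// subrr.
have F1 x : `|F x| <= 1.
  have m0 : 0 <= m by rewrite divr_ge0 ?(ltW N0)// sumr_ge0// => y _; case/andP: (f01 y).
  have m1 : m <= 1.
    rewrite ler_pdivrMr// mul1r /N -sum1_card natr_sum.
    by apply: ler_sum => y _; case/andP: (f01 y).
  by have /andP[] := f01 x; rewrite ler_norml /F => *; apply/andP; split; lra.
have wE j : dot F (iter j (averaging A) F) / N = dot f (iter j (averaging A) f) / N - m * m.
  have -> : dot F (iter j (averaging A) F) = dot f (iter j (averaging A) f) - N * m * m.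
    rewrite /dot; under eq_bigr do rewrite /F iter_avgB iter_avg_cst mulrBr.
    rewrite sumrB -mulr_suml F0 mul0r subr0.
    under eq_bigr do rewrite mulrBl.
    by rewrite sumrB -mulr_sumr sum_iter_avg//; congr (_ - _); rewrite /m; field.
  by field.
rewrite l1 l2; set D := law f f.
have cvD : poisson_partial r (fun j => dot F (iter j (averaging A) F) / N) @ \oo --> D - m * m.
  have -> : poisson_partial r (fun j => dot F (iter j (averaging A) F) / N) =
     (fun n => poisson_partial r (fun j => dot f (iter j (averaging A) f) / N) n -
        poisson_partial r (fun=> m * m) n).
    apply/funext => n; rewrite -poisson_partialB /poisson_partial; congr (_ * _).
    by apply: eq_bigr => j _; rewrite wE.
  by apply: cvgB; [exact: poisson_partial_law|exact: poisson_partial_cst].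
rewrite -(cvg_lim _ cvD)// -lim_norm; last by apply/cvg_ex; exists (D - m * m).
have sq0 k : 0 <= iter_sqnorm A k F by exact: dot_ge0.
apply: limr_le; first by apply: is_cvg_norm; apply/cvg_ex; exists (D - m * m).
near=> n; apply: poisson_partial_le.
- exact: jump_rate_gt0.
- by rewrite divr_ge0 ?(ltW N0).
- move=> j; rewrite normrM normfV (ger0_norm (ltW N0)) ler_pdivrMr// mul1r.
  apply: le_trans (dot_iter_avg_le A0 AV F j) _.
  apply: le_trans (iter_sqnorm_noninc A0 AV F (leq0n _)) _.
  rewrite /iter_sqnorm /= /dot /N -sum1_card natr_sum; apply: ler_sum => x _.
  by rewrite -[F x * F x]ger0_norm -?expr2 ?sqr_ge0// normrX expr_le1.
- move=> j Jj; rewrite normrM normfV (ger0_norm (ltW N0)) ler_wpM2r ?invr_ge0 ?(ltW N0)//.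
  apply: le_trans (dot_iter_avg_le A0 AV F j) _; apply: iter_sqnorm_noninc => //.
  by rewrite -(doubleK J) half_leq.
Unshelve. all: by end_near. Qed.

End CovarianceBound.

Section SpectralGap.
Variables (R : realType).

(** After division by the powers of X the polynomial does not vanish at 0, hence not
    near 0 by continuity. *)
Lemma positive_roots_away (p : {poly R}) : p != 0 ->
  exists2 e : R, 0 < e & forall a, 0 < a -> root p a -> e <= a.
Proof.
move=> p0; have [m [q]] := multiplicity_XsubC p 0; rewrite p0 /= => q0 pE.
have : \forall x \near (0 : R), q.[x] != 0.
  apply: (@continuous_horner R q 0 [set x | x != 0]).
  apply: open_nbhs_nbhs; split; last exact: q0.
  rewrite (_ : [set x | x != 0] = ~` [set 0]).
    by rewrite openC; exact: closed_eq.
  by apply/seteqP; split=> x /=; move/eqP.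
move=> /nbhs_ballP[e /= e0 qe]; exists e => // a a0; rewrite leNgt pE => pa; apply/negP => ae.
have := qe a; rewrite /ball /= sub0r normrN gtr0_norm// => /(_ ae).
move: pa; rewrite subr0 rootE hornerM mulf_eq0 => /orP[/eqP ->|]; first by rewrite eqxx.
by rewrite hornerXn expf_eq0 gt_eqF// andbF.
Qed.

Variables (S : finType) (Q : (S -> R) -> S -> R).
Hypothesis Qlin : forall f x, Q f x = \sum_y f y * Q (fun z => (z == y)%:R) x.

(** The eigenvalues of - Q are roots of a characteristic polynomial, so the positive
    ones stay away from 0. Without this the infimum could be 0 and the relaxation
    time with it. *)
Lemma spectral_gap_bounds a : 0 < a -> eigenvalue_of_opp Q a ->
  0 < spectral_gap Q <= a.
Proof.
move=> a0 Qa; pose n := #|S|.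
pose M : 'M[R]_n := \matrix_(i, j) - Q (fun z => (z == enum_val i)%:R) (enum_val j).
have [e e0 He] := positive_roots_away (monic_neq0 (char_poly_monic M)).
have eigM b : eigenvalue_of_opp Q b -> root (char_poly M) b.
  move=> [f [x fx] Qf]; rewrite -eigenvalue_root_char; apply/eigenvalueP.
  exists (\row_i f (enum_val i)).
    apply/rowP => j; rewrite !mxE -Qf Qlin -sumrN (reindex _ (onW_bij _ (@enum_val_bij S))) /=.
    by apply: eq_bigr => i _; rewrite !mxE mulrN.
  apply/eqP => /rowP/(_ (enum_rank x)); rewrite !mxE enum_rankK => f0.
  by rewrite f0 eqxx in fx.
have lb : lbound [set b | 0 < b /\ eigenvalue_of_opp Q b] e.
  by move=> b [b0 Qb]; apply: He => //; exact: eigM.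
apply/andP; split.
  by apply: lt_le_trans e0 _; apply: lb_le_inf => //; exists a.
by apply: ge_inf => //; exists e.
Qed.

End SpectralGap.

Lemma translation_generator_linear (R : realType) (gT : finGroupType) (A : {set gT}) (nu : R) f x :
  translation_generator A nu f x = \sum_y f y * translation_generator A nu (fun z => (z == y)%:R) x.
Proof.
have fE z : f z = \sum_y f y * (z == y)%:R.
  rewrite (bigD1 z)//= eqxx mulr1 big1 ?addr0// => y.
  by rewrite eq_sym => /negPf ->; rewrite mulr0.
rewrite /translation_generator; under [RHS]eq_bigr do rewrite mulrCA mulr_sumr.
rewrite -mulr_sumr exchange_big /=; congr (_ * _); apply: eq_bigr => s _.
under [RHS]eq_bigr do rewrite mulrBr.
by rewrite sumrB -!fE.
Qed.

(** * Noise sensitivity *)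

Section UniformDecay.
Variables (R : realType) (c : R).
Hypothesis c0 : 0 < c.

Lemma card_initial_segment n k : (k <= n)%N -> #|[set i : 'I_n | (i < k)%N]%SET| = k.
Proof.
move=> kn; have inj : injective (widen_ord kn)
  by move=> i j ij; apply: val_inj; exact: (congr1 (fun u : 'I_n => val u) ij).
have -> : [set i : 'I_n | (i < k)%N]%SET = (widen_ord kn @: [set: 'I_k])%SET.
  apply/setP => i; rewrite inE; apply/idP/imsetP => [ik|[j _ ->]] //.
    by exists (Ordinal ik); rewrite ?inE//; apply: val_inj.
  by rewrite /= ltn_ord.
by rewrite card_imset// cardsT card_ord.
Qed.

Lemma has_large_cycleE n (s : 'S_n) : (0 < n)%N ->
  has_large_cycle c s = large_orbit_in c [set: 'I_n]%SET s.
Proof.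
move=> n0; rewrite /has_large_cycle /large_orbit_in cardsT card_ord.
have x0 : 'I_n by exists 0%N.
apply/idP/existsP => [|[x]].
  have [|C CP E] := @eq_bigmax_cond _ (mem (porbits s)) (fun C : {set 'I_n} => #|C|).
    by apply/card_gt0P; exists (porbit s x0); apply: imset_f.
  have -> : largest_cycle s = #|C| by exact: E.
  by move: CP => /imsetP[x _ ->] H; exists x; rewrite finset.setIT.
rewrite finset.setIT => H; apply: le_trans H _; rewrite ler_nat.
by apply: (@leq_bigmax_cond _ (mem (porbits s)) (fun C : {set 'I_n} => #|C|)); apply: imset_f.
Qed.

(** The parameters are chosen in the order e, #|A|, #|B|, lam, J and only then n;
    each of the terms of iter_sqnorm_centered_le is at most eps / 6, except the
    first, which is at most eps / 3. None of them depends on the generators. *)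
Lemma iter_sqnorm_centered_small (eps : R) : 0 < eps -> exists J n1 : nat,
  forall n, (n1 <= n)%N -> forall (G : {set 'S_n}) (z : 'I_n),
  G != finset.set0 -> (forall s, s \in G -> (s^-1)%g \in G) ->
  reaches_star_pairs G z ->
  iter_sqnorm G J (centered c) <= (n`!)%:R * eps.
Proof.
move=> eps0.
have trunc (x : R) : x <= (Num.truncn x).+1%:R by apply/ltW/truncnS_gt.
(* The window of cycle lengths has relative width of order 8 * e / c. *)
pose e := c * Num.min (1 / 2) (eps / 48).
have e0 : 0 < e by rewrite mulr_gt0// lt_min !divr_gt0.
have e1 : e <= c / 2 by rewrite /e mulrC -ler_pdivlMr// mulrAC divff ?gt_eqF// ge_min lexx.
have e2 : 8 * e <= c * (eps / 6).
  apply: (@le_trans _ _ (8 * (c * (eps / 48)))); last by lra.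
  by rewrite ler_pM2l// ler_pM2l// ge_min lexx orbT.
clearbody e.
pose m' := (Num.truncn (6 / (eps * e ^+ 2))).+1.
have m'P : (m'%:R * e ^+ 2)^-1 <= eps / 6.
  have := trunc (6 / (eps * e ^+ 2)); rewrite -/m'.
  rewrite ler_pdivrMr ?mulr_gt0 ?exprn_gt0// => H.
  rewrite -[leLHS]mul1r ler_pdivrMr ?mulr_gt0 ?exprn_gt0 ?ltr0n//.
  by move: H; rewrite mulrCA; set w := _ * e ^+ 2; lra.
(* m * (m - 1) is at least m' ^ 2 * k. *)
pose k := (Num.truncn (6 / eps)).+1; pose m := (m' ^ 2 * k).+2.
have kP : k%:R^-1 <= eps / 6.
  have := trunc (6 / eps); rewrite -/k ler_pdivrMr// => H.
  by rewrite -[leLHS]mul1r ler_pdivrMr ?ltr0n//; lra.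
have mP : (m' ^ 2)%:R / (m * m.-1)%:R <= eps / 6.
  apply: le_trans kP; rewrite ler_pdivrMr ?ltr0n// mulrC ler_pdivlMr ?ltr0n//.
  by rewrite -natrM ler_nat /m /=; move: (m' ^ 2)%N => q; nia.
have m'm : (m' <= m)%N by rewrite /m /k -mulnn; nia.
pose lam := eps / 3; have lam0 : 0 < lam by rewrite divr_gt0.
pose J := (Num.truncn (6 * 32 * (2 ^ m)%:R / (lam * eps))).+1.
have JP : 32 * (2 ^ m)%:R / (lam * J%:R) <= eps / 6.
  have := trunc (6 * 32 * (2 ^ m)%:R / (lam * eps)); rewrite -/J.
  rewrite ler_pdivrMr ?mulr_gt0// ler_pdivrMr ?mulr_gt0 ?ltr0n//.
  by move: (2 ^ m)%:R => q; move: J%:R => j; lra.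
pose n1 := maxn m (maxn (Num.truncn (4 / c)).+1 (Num.truncn (72 / (c * eps))).+1).
exists J, n1 => n; rewrite !geq_max => /and3P[mn n4 n72] G z G0 GV G3.
have n4' : 4 <= c * n%:R.
  by rewrite mulrC -ler_pdivrMr//; apply: le_trans (trunc _) _; rewrite ler_nat.
have n72' : 72 <= c * eps * n%:R.
  by rewrite mulrC -ler_pdivrMr ?mulr_gt0//; apply: le_trans (trunc _) _; rewrite ler_nat.
pose A := [set i : 'I_n | (i < m')%N]%SET; pose B := [set i : 'I_n | (i < m)%N]%SET.
have cA : #|A| = m' by rewrite card_initial_segment// (leq_trans m'm).
have cB : #|B| = m by rewrite card_initial_segment.
have A0 : A != finset.set0 by rewrite -card_gt0 cA.
have AB : A \subset B by apply/fintype.subsetP => i; rewrite !inE => /leq_trans; apply.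
pose a := Num.truncn ((c - e) * n%:R); pose b := (Num.truncn ((c + e) * n%:R)).+1.
have n0 : 0 <= n%:R :> R by [].
have ce0 : 0 <= (c - e) * n%:R by rewrite mulr_ge0//; lra.
have ce1 : 0 <= (c + e) * n%:R by rewrite mulr_ge0//; lra.
have ha : a%:R <= (c - e) * n%:R by rewrite truncn_le.
have ha' : (c - e) * n%:R < a%:R + 1 by rewrite natr1; exact: truncnS_gt.
have hb : (c + e) * n%:R <= b%:R by exact: trunc.
have hb' : b%:R <= (c + e) * n%:R + 1 by rewrite /b -natr1 lerD2r truncn_le.
have enc : e * n%:R <= c * n%:R / 2 by rewrite mulrAC ler_wpM2r.
have a1 : c * n%:R / 4 <= a%:R by move: ha' enc n4'; rewrite !mulrBl; lra.
have a0 : (0 < a)%N by rewrite -(ltr_nat R); lra.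
have win : (b.+1 - a)%:R / a%:R <= eps / 6 + eps / 6.
  have ab : (a <= b.+1)%N by rewrite -(ler_nat R) -[b.+1%:R]natr1; move: ha hb; rewrite mulrBl mulrDl; nra.
  rewrite ler_pdivrMr ?ltr0n// natrB// -[b.+1%:R]natr1.
  apply: (@le_trans _ _ ((eps / 6 + eps / 6) * (c * n%:R / 4))); last first.
    by rewrite ler_wpM2l//; lra.
  move: ha' hb'; rewrite mulrBl mulrDl => ha' hb'.
  have e3 : 8 * (e * n%:R) <= c * n%:R * (eps / 6).
    by rewrite mulrA (_ : c * n%:R * _ = c * (eps / 6) * n%:R) ?ler_wpM2r//; ring.
  move: e3 n72'; rewrite (_ : c * eps * n%:R = c * n%:R * eps); last by ring.
  by move: ha' hb'; move: (c * n%:R) (e * n%:R) => u v; lra.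
have B2 : (1 < #|B|)%N by rewrite cB.
have nI : n%:R = #|'I_n|%:R :> R by rewrite card_ord.
rewrite nI in ha hb.
have := iter_sqnorm_centered_le G0 GV G3 c0 (ltn0Sn _ : (0 < J)%N) A0 AB B2 e0 lam0 a0 ha hb.
move=> /le_trans; apply; rewrite card_ord ler_wpM2l// cA cB.
have l2 : lam / 2 = eps / 6 by rewrite /lam; field.
rewrite l2; apply: (@le_trans _ _ (eps / 6 + eps / 6 + eps / 6 + eps / 6 + eps / 6 + eps / 6)); last by lra.
by rewrite !lerD.
Qed.

End UniformDecay.

Section NoiseSensitivity.
Variables (R : realType) (c : R).
Hypothesis c0 : 0 < c.

(** Since the gap is at most nu * l, the mean number nu #|G| alpha / gap of jumps is at
    least alpha #|G| / l. *)
Lemma walk_covariance_bound n (G : {set 'S_n}) (nu l alpha : R) (J : nat)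
    (d : measure_display) (Omega : measurableType d) (P : probability Omega R)
    (X : R -> Omega -> 'S_n) :
  (0 < n)%N -> 0 < nu -> 0 < l -> 0 < alpha -> G != finset.set0 ->
  (forall s, s \in G -> (s^-1)%g \in G) ->
  eigenvalue_of_opp (walk_generator nu G) (nu * l) ->
  is_markov_chain P (walk_generator nu G) (uniform_dist R 'S_n) X ->
  exists2 r : R, covariance P (fun w => (has_large_cycle c (X 0 w))%:R)
     (fun w => (has_large_cycle c (X (alpha * relaxation_time (walk_generator nu G)) w))%:R) = r%:E &
   `|r| <= (J.*2 ^ 2)%:R * l / (alpha * #|G|%:R) + iter_sqnorm G J (centered c) / (n`!)%:R.
Proof.
move=> n0 nu0 l0 al0 G0 GV eig chain.
have /andP[g0 gl] : 0 < spectral_gap (walk_generator nu G) <= nu * l.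
  by apply: spectral_gap_bounds => //; [exact: translation_generator_linear|exact: mulr_gt0].
set t := alpha * relaxation_time _.
have t0 : 0 < t by rewrite mulr_gt0// invr_gt0.
rewrite (markov_chain_covariance (@has_large_cycle R n c) (ltW t0) chain) /=; eexists; first by [].
set f := fun x : 'S_n => _.
have f01 x : 0 <= f x <= 1 by rewrite /f; case: has_large_cycle; rewrite ler01 lexx.
apply: le_trans (covariance_law_le G0 GV nu0 t0 J f01) _.
have cG := card_gen_gt0 R G0.
apply: lerD.
  rewrite -[leRHS]mulrA ler_wpM2l// -[l in leRHS]invrK -invfM.
  have p1 : 0 < nu * #|G|%:R * t by rewrite (mulr_gt0 (mulr_gt0 nu0 cG) t0).
  have p2 : 0 < l^-1 * (alpha * #|G|%:R) by rewrite mulr_gt0 ?invr_gt0// mulr_gt0.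
  rewrite lef_pV2//.
  rewrite ler_pdivrMl//.
  have -> : l * (nu * #|G|%:R * t) = (nu * l) * (alpha * #|G|%:R) / spectral_gap (walk_generator nu G).
    by rewrite /t /relaxation_time; ring.
  by rewrite ler_pdivlMr// mulrC ler_wpM2r ?mulr_ge0// ltW.
rewrite card_perm_type card_ord.
suff -> : (fun x => f x - (\sum_x f x) / (n`!)%:R) = centered c by [].
apply/funext => x; rewrite /centered card_ord /large_cycle /f has_large_cycleE//.
by congr (_ - _ / _); apply: eq_bigr => y _; rewrite has_large_cycleE.
Qed.

Lemma walk_noise_sensitive (G : forall n, {set 'S_n}) (nu l : nat -> R) :
  (forall n, 0 < nu n) ->
  (\forall n \near \oo, [/\ 0 < l n, G n != finset.set0,
     (forall s, s \in G n -> (s^-1)%g \in G n),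
     eigenvalue_of_opp (walk_generator (nu n) (G n)) (nu n * l n) &
     exists z, reaches_star_pairs (G n) z]) ->
  l n / #|G n|%:R @[n --> \oo] --> 0 ->
  noise_sensitive (fun n => walk_generator (nu n) (G n))
       (fun n => uniform_dist R 'S_n) (fun n => @has_large_cycle R n c).
Proof.
move=> nu0 GP lG alpha al0 d Omega P X chain.
set C := fun n => covariance _ _ _.
have key eps : 0 < eps -> \forall n \near \oo, exists2 r : R, C n = r%:E & `|r| <= eps.
  move=> eps0; have eps2 : 0 < eps / 2 by rewrite divr_gt0.
  have [J [n1 HJ]] := iter_sqnorm_centered_small c0 eps2.
  pose del := eps / 2 * alpha / (J.*2 ^ 2).+1%:R.
  have del0 : 0 < del by rewrite !mulr_gt0 ?invr_gt0 ?ltr0n.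
  have lG' : \forall n \near \oo, `|0 - l n / #|G n|%:R| <= del.
    by move/cvgrPdist_le: lG; apply.
  near=> n.
  have [l0 G0 GV eig [z Gz]] : [/\ 0 < l n, G n != finset.set0,
     (forall s, s \in G n -> (s^-1)%g \in G n),
     eigenvalue_of_opp (walk_generator (nu n) (G n)) (nu n * l n) &
     exists z, reaches_star_pairs (G n) z] by near: n.
  have n0 : (0 < n)%N by near: n; exact: nbhs_infty_gt.
  have nn1 : (n1 <= n)%N by near: n; exact: nbhs_infty_ge.
  have lGn : l n / #|G n|%:R <= del.
    have : `|0 - l n / #|G n|%:R| <= del by near: n; exact: lG'.
    by rewrite sub0r normrN ger0_norm// divr_ge0// ltW.
  have [r Cr rb] := walk_covariance_bound J n0 (nu0 n) l0 al0 G0 GV eig (chain n).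
  exists r => //; apply: le_trans rb _.
  have -> : eps = eps / 2 + eps / 2 by lra.
  apply: lerD; last first.
    by rewrite ler_pdivrMr ?ltr0n ?fact_gt0// mulrC; exact: HJ Gz.
  have -> : (J.*2 ^ 2)%:R * l n / (alpha * #|G n|%:R) =
      (J.*2 ^ 2)%:R / alpha * (l n / #|G n|%:R).
    by rewrite invfM; ring.
  apply: (@le_trans _ _ ((J.*2 ^ 2)%:R / alpha * del)).
    by rewrite ler_wpM2l// divr_ge0// ltW.
  rewrite /del; have -> : (J.*2 ^ 2)%:R / alpha * (eps / 2 * alpha / (J.*2 ^ 2).+1%:R) =
      eps / 2 * ((J.*2 ^ 2)%:R / (J.*2 ^ 2).+1%:R).
    by field; rewrite ?nat1r ?pnatr_eq0 ?gt_eqF.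
  by rewrite -[leRHS]mulr1 ler_wpM2l ?(ltW eps2)// ler_pdivrMr ?ltr0n// mul1r ler_nat.
apply/fine_cvgP; split.
  by near=> n; have [r -> _] : exists2 r : R, C n = r%:E & `|r| <= 1 by near: n; exact: key.
apply/cvgrPdist_le => eps eps0; near=> n.
have [r rE rb] : exists2 r : R, C n = r%:E & `|r| <= eps by near: n; exact: key.
by rewrite /= -/(C n) rE /= sub0r normrN.
Unshelve. all: by end_near. Qed.

End NoiseSensitivity.

Lemma star_noise_sensitive (R : realType) (c : R) (nu : nat -> R) :
  0 < c -> (forall n, 0 < nu n) ->
  noise_sensitive (fun n => interchange_generator (nu n) (@star n))
    (fun n => uniform_dist R 'S_n) (fun n => @has_large_cycle R n c).
Proof.
move=> c0 nu0.
apply: (@walk_noise_sensitive R c c0 (fun n => edge_transpositions (@star n)) nu (fun=> 1) nu0).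
  exists 3%N => // n /=; case: n => [//|[//|n]] n1; split => //.
  - exact: star_neq0.
  - exact: starV.
  - exact: star_eigenvalue.
  - by exists ord_max; exact: star_reaches_star_pairs.
apply/cvgrPdist_le => eps eps0; exists (Num.truncn eps^-1 + 3)%N => // n /=.
case: n => [|[|n]]; rewrite ?addn3 // !ltnS => Hn.
rewrite card_star sub0r normrN ger0_norm ?divr_ge0// ler_pdivrMr ?ltr0n//.
rewrite -ler_pdivrMl// mulr1; apply: ltW; apply: lt_le_trans (truncnS_gt _) _.
by rewrite ler_nat (leq_trans Hn).
Qed.

Lemma cycle_noise_sensitive (R : realType) (c : R) (nu : nat -> R) (s : nat -> nat) :
  0 < c -> (forall n, 0 < nu n) -> (\forall n \near \oo, (1 < s n)%N) ->
  (s n)%:R / n%:R @[n --> \oo] --> (0 : R) ->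
  noise_sensitive (fun n => cycle_generator (nu n) (s n))
    (fun n => uniform_dist R 'S_n) (fun n => @has_large_cycle R n c).
Proof.
move=> c0 nu0 s1 sn0.
have sn eps : 0 < eps -> \forall n \near \oo, (s n)%:R <= eps * n%:R :> R.
  move=> eps0; have H : \forall n \near \oo, `|0 - (s n)%:R / n%:R| <= eps.
    by move/cvgrPdist_le: sn0; apply.
  near=> n; have n0 : (0 < n)%N by near: n; exact: nbhs_infty_gt.
  have : `|0 - (s n)%:R / n%:R| <= eps by near: n.
  by rewrite sub0r normrN ger0_norm ?divr_ge0// ler_pdivrMr// ltr0n.
pose G n := s_cycles n (s n).
(* The eigenvalue of conj_set_eigenvalue, so that l n / #|G n| is s n / (n - 1). *)
pose l n : R := #|G n|%:R * (s n)%:R / n.-1%:R.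
have facts : \forall n \near \oo, [/\ (1 < s n)%N, (s n < n)%N & (1 < n)%N].
  near=> n; have n1 : (1 < n)%N by near: n; exact: nbhs_infty_gt.
  have s1n : (1 < s n)%N by near: n.
  split=> //; have : (s n)%:R <= 1 / 2 * n%:R :> R by near: n; apply: sn; rewrite divr_gt0.
  have : 1 < n%:R :> R by rewrite ltr1n.
  by rewrite -(ltr_nat R); lra.
apply: (@walk_noise_sensitive R c c0 G nu l nu0).
  near=> n; have [s1n snn n1] : [/\ (1 < s n)%N, (s n < n)%N & (1 < n)%N] by near: n.
  have G0 : G n != finset.set0 by apply: s_cycles_neq0 => //; exact: ltnW.
  split => //.
  - rewrite /l !mulr_gt0 ?invr_gt0 ?ltr0n ?card_gt0//; first exact: ltnW.
    by rewrite -subn1 subn_gt0.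
  - exact: s_cyclesV.
  - apply: conj_set_eigenvalue => //; [exact: s_cyclesJ|exact: ltnW|].
    by move=> u; exact: s_cycles_support.
  - by exists (Ordinal (ltnW n1)); exact: s_cycles_reach_star_pairs.
apply/cvgrPdist_le => eps eps0; near=> n.
have [s1n snn n1] : [/\ (1 < s n)%N, (s n < n)%N & (1 < n)%N] by near: n.
have G0 : G n != finset.set0 by apply: s_cycles_neq0 => //; exact: ltnW.
have sle : (s n)%:R <= eps / 2 * n%:R :> R by near: n; apply: sn; rewrite divr_gt0.
have nn : n%:R <= 2 * n.-1%:R :> R by rewrite -natrM ler_nat; lia.
have n10 : 0 < n.-1%:R :> R by rewrite ltr0n; lia.
have cG := card_gen_gt0 R G0.
have lE : l n / #|G n|%:R = (s n)%:R / n.-1%:R by rewrite /l; field; rewrite !gt_eqF.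
rewrite sub0r normrN lE.
rewrite ger0_norm ?divr_ge0// ler_pdivrMr//.
apply: le_trans sle _; apply: le_trans (ler_wpM2l _ nn) _; first by rewrite divr_ge0// ltW.
by rewrite mulrA divfK.
Unshelve. all: by end_near. Qed.

Theorem mainTheorem6 (R : realType) (c : R) (hc0 : 0 < c) (hc1 : c < 1) :
  (forall nu : nat -> R, (forall n, 0 < nu n) ->
     noise_sensitive
       (fun n => interchange_generator (nu n) (@star n))
       (fun n => uniform_dist R 'S_n)
       (fun n => @has_large_cycle R n c)) /\
  (forall (nu : nat -> R) (n0 : nat) (s : nat -> nat),
     (forall n, 0 < nu n) ->
     (4 <= n0)%N ->
     (forall n, (n0 <= n)%N -> [/\ ~~ odd (s n), (2 < s n)%N & (s n <= n)%N]) ->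
     ((s n)%:R / n%:R : R) @[n --> \oo] --> (0 : R) ->
     noise_sensitive
       (fun n => cycle_generator (nu n) (s n))
       (fun n => uniform_dist R 'S_n)
       (fun n => @has_large_cycle R n c)).
Proof.
split=> [nu nu0|nu n0 s nu0 _ sP sn]; first exact: star_noise_sensitive.
apply: cycle_noise_sensitive => //; exists n0 => // n /= /sP[_ + _].
exact: ltnW.
Qed.
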